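(* Let $k$ be a field and $R=k[[x,y]]/(x^3+y^2)$. Then the global spectrum of $R$ is $\operatorname{gs}(R)=\{1,2\}$.
   Context: For a commutative Cohen--Macaulay ring $R$, the global spectrum $\operatorname{gs}(R)$ is the set of all finite values of $\operatorname{gldim} \operatorname{End}_R(M)$, where $M$ ranges over (nonzero) maximal Cohen--Macaulay $R$-modules; maximal Cohen--Macaulay modules are not required to have full support. *)

(* Defs.v *)
From HB Require Import structures.
From mathcomp Require Import all_boot all_order all_algebra ring_quotient.
From mathcomp Require Import boolp classical_sets.

Set Implicit Arguments.
Unset Strict Implicit.
Unset Printing Implicit Defensive.

Import GRing.Theory.
Local Open Scope ring_scope.

(* [fps_coef f i j] is the coefficient of x^i y^j. *)
Record fps2 (A : Type) := Fps2 { fps_coef : nat -> nat -> A }.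

HB.instance Definition _ (A : Type) := gen_eqMixin (fps2 A).
HB.instance Definition _ (A : Type) := gen_choiceMixin (fps2 A).

Lemma fps2P (A : Type) (f g : fps2 A) :
  (forall i j, fps_coef f i j = fps_coef g i j) -> f = g.
Proof.
case: f g => [f] [g] /= H; congr Fps2.
by apply: funext => i; apply: funext => j.
Qed.

Section FpsRing.
Variable A : comNzRingType.
Implicit Types f g h : fps2 A.

Definition fps_zero : fps2 A := Fps2 (fun _ _ => 0).
Definition fps_opp f : fps2 A := Fps2 (fun i j => - fps_coef f i j).
Definition fps_add f g : fps2 A :=
  Fps2 (fun i j => fps_coef f i j + fps_coef g i j).
Definition fps_one : fps2 A :=
  Fps2 (fun i j => ((i == 0%N) && (j == 0%N))%:R).
Definition fps_mul f g : fps2 A :=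
  Fps2 (fun i j => \sum_(a < i.+1) \sum_(b < j.+1)
                     fps_coef f a b * fps_coef g (i - a) (j - b)).

Fact fps_addA : associative fps_add.
Proof. by move=> f g h; apply: fps2P => i j /=; rewrite addrA. Qed.
Fact fps_addC : commutative fps_add.
Proof. by move=> f g; apply: fps2P => i j /=; rewrite addrC. Qed.
Fact fps_add0 : left_id fps_zero fps_add.
Proof. by move=> f; apply: fps2P => i j /=; rewrite add0r. Qed.
Fact fps_addN : left_inverse fps_zero fps_opp fps_add.
Proof. by move=> f; apply: fps2P => i j /=; rewrite addNr. Qed.

HB.instance Definition _ :=
  GRing.isZmodule.Build (fps2 A) fps_addA fps_addC fps_add0 fps_addN.

(* Truncations in A[y][x], from which associativity is transported. *)
Let tr n f : {poly {poly A}} :=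
  \poly_(i < n) \poly_(j < n) fps_coef f i j.

Let trE n f i j : (i < n)%N -> (j < n)%N -> (tr n f)`_i`_j = fps_coef f i j.
Proof. by move=> ltin ltjn; rewrite !(coef_poly, ltin, ltjn). Qed.

Let mulE (p q : {poly {poly A}}) i j :
  (p * q)`_i`_j = \sum_(a < i.+1) \sum_(b < j.+1) p`_a`_b * q`_(i - a)`_(j - b).
Proof. by rewrite coefM coef_sum; apply: eq_bigr => a _; rewrite coefM. Qed.

Let fps_mulE n f g i j : (i < n)%N -> (j < n)%N ->
  fps_coef (fps_mul f g) i j = (tr n f * tr n g)`_i`_j.
Proof.
move=> ltin ltjn; rewrite mulE /=; apply: eq_bigr => a _; apply: eq_bigr => b _.
have le1 (c d : nat) : (d < n -> c < d.+1 -> c < n)%N.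
  by move=> dn cd; apply: leq_ltn_trans dn.
have le2 (c d : nat) : (d < n -> d - c < n)%N by apply/leq_ltn_trans/leq_subr.
by rewrite !trE ?(le1 a i) ?(le1 b j) ?le2.
Qed.

Let mul_congr n (p p' q q' : {poly {poly A}}) :
  (forall i j, (i < n)%N -> (j < n)%N -> p`_i`_j = p'`_i`_j) ->
  (forall i j, (i < n)%N -> (j < n)%N -> q`_i`_j = q'`_i`_j) ->
  forall i j, (i < n)%N -> (j < n)%N -> (p * q)`_i`_j = (p' * q')`_i`_j.
Proof.
move=> Hp Hq i j ltin ltjn; rewrite !mulE.
apply: eq_bigr => a _; apply: eq_bigr => b _.
by rewrite Hp ?Hq //; first [exact: leq_ltn_trans (leq_subr _ _) _
  | apply: leq_ltn_trans ltin; rewrite -ltnS; exact: ltn_ord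
  | apply: leq_ltn_trans ltjn; rewrite -ltnS; exact: ltn_ord].
Qed.

Fact fps_mulC : commutative fps_mul.
Proof.
move=> f g; apply: fps2P => i j.
have [n [ltin ltjn]]: exists n, (i < n)%N /\ (j < n)%N.
  by exists (maxn i j).+1; rewrite !ltnS leq_maxl leq_maxr.
by rewrite !(@fps_mulE n) // mulrC.
Qed.

Fact fps_mulA : associative fps_mul.
Proof.
move=> f g h; apply: fps2P => i j.
have [n [ltin ltjn]]: exists n, (i < n)%N /\ (j < n)%N.
  by exists (maxn i j).+1; rewrite !ltnS leq_maxl leq_maxr.
have E u v a b : (a < n)%N -> (b < n)%N ->
    (tr n (fps_mul u v))`_a`_b = (tr n u * tr n v)`_a`_b.
  by move=> lta ltb; rewrite trE // (@fps_mulE n).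
rewrite !(@fps_mulE n) //.
rewrite (mul_congr (fun a b _ _ => erefl) (E g h) ltin ltjn).
by rewrite (mul_congr (E f g) (fun a b _ _ => erefl) ltin ltjn) mulrA.
Qed.

Fact fps_mul1 : left_id fps_one fps_mul.
Proof.
move=> f; apply: fps2P => i j /=.
rewrite big_ord_recl big_ord_recl /= mul1r !subn0.
rewrite big1 ?addr0 => [|b _]; last by rewrite /= mul0r.
by rewrite big1 ?addr0 // => a _; rewrite big1 // => b _; rewrite mul0r.
Qed.

Fact fps_mulDl : left_distributive fps_mul fps_add.
Proof.
move=> f g h; apply: fps2P => i j /=; rewrite -big_split.
by apply: eq_bigr => a _; rewrite -big_split; apply: eq_bigr => b _;
   rewrite mulrDl.
Qed.

Fact fps_oner_neq0 : fps_one != fps_zero.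
Proof.
apply/eqP => /(congr1 (fun f => fps_coef f 0 0)) /= /eqP.
by rewrite oner_eq0.
Qed.

HB.instance Definition _ := GRing.Zmodule_isComNzRing.Build (fps2 A)
  fps_mulA fps_mulC fps_mul1 fps_mulDl fps_oner_neq0.

Definition fps_X : fps2 A := Fps2 (fun i j => ((i == 1%N) && (j == 0%N))%:R).
Definition fps_Y : fps2 A := Fps2 (fun i j => ((i == 0%N) && (j == 1%N))%:R).

End FpsRing.

Lemma fps_coefM (A : comNzRingType) (f g : fps2 A) i j :
  fps_coef (f * g) i j = \sum_(a < i.+1) \sum_(b < j.+1)
                           fps_coef f a b * fps_coef g (i - a) (j - b).
Proof. by []. Qed.

Lemma fps_coefD (A : comNzRingType) (f g : fps2 A) i j :
  fps_coef (f + g) i j = fps_coef f i j + fps_coef g i j.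
Proof. by []. Qed.

Section Cusp.
Variable k : fieldType.

Definition cusp_poly : fps2 k := fps_X k ^+ 3 + fps_Y k ^+ 2.

Definition cusp_ideal : {pred fps2 k} :=
  fun f => `[< exists g, f = g * cusp_poly >].

Lemma cusp_ideal_closed : idealr_closed cusp_ideal.
Proof.
split.
- by apply/asboolP; exists 0; rewrite mul0r.
- apply/asboolP => -[g] /(congr1 (fun f => fps_coef f 0 0)).
  rewrite /cusp_poly !exprS !expr0 !mulr1 !(fps_coefM, fps_coefD, big_ord1) /=.
  rewrite !(mulr0, mul0r, addr0).
  by apply/eqP; rewrite oner_eq0.
- move=> a f g /asboolP[f' ->] /asboolP[g' ->]; apply/asboolP.
  by exists (a * f' + g'); rewrite mulrDl mulrA.
Qed.

HB.instance Definition _ := GRing.isZmodClosed.Build (fps2 k) cusp_ideal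
  (idealr_closedB cusp_ideal_closed).
HB.instance Definition _ := isProperIdeal.Build (fps2 k) cusp_ideal
  (idealr_closed_nontrivial cusp_ideal_closed).

Definition cusp_ring : comNzRingType := {ideal_quot cusp_ideal}.

End Cusp.

Definition End_ring (R : pzRingType) (M : lmodType R) : Type := {linear M -> M}.

Section EndRing.
Variables (R : pzRingType) (M : lmodType R).
Local Notation E := (End_ring M).

HB.instance Definition _ := gen_eqMixin E.
HB.instance Definition _ := gen_choiceMixin E.

Definition End_fun (f : E) : {linear M -> M} := f.

Lemma End_ringP (f g : E) : End_fun f =1 End_fun g -> f = g.
Proof.
case: f g => [f [[Hf0] [Hf]]] [g [[Hg0] [Hg]]] H.
have eqfg : f = g by apply: funext.
case: g / eqfg Hg0 Hg H => Hg0 Hg _.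
by rewrite (Prop_irrelevance Hf0 Hg0) (Prop_irrelevance Hf Hg).
Qed.

Definition End_zero : E := [the {linear M -> M} of \0].
Definition End_opp (f : E) : E := [the {linear M -> M} of \- End_fun f].
Definition End_add (f g : E) : E :=
  [the {linear M -> M} of End_fun f \+ End_fun g].
Definition End_one : E := [the {linear M -> M} of idfun].
Definition End_mul (f g : E) : E :=
  [the {linear M -> M} of End_fun f \o End_fun g].

Fact End_addA : associative End_add.
Proof. by move=> f g h; apply: End_ringP => v /=; rewrite addrA. Qed.
Fact End_addC : commutative End_add.
Proof. by move=> f g; apply: End_ringP => v /=; rewrite addrC. Qed.
Fact End_add0 : left_id End_zero End_add.
Proof. by move=> f; apply: End_ringP => v /=; rewrite add0r. Qed.
Fact End_addN : left_inverse End_zero End_opp End_add.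
Proof. by move=> f; apply: End_ringP => v /=; rewrite addNr. Qed.
Fact End_mulA : associative End_mul.
Proof. by move=> f g h; apply: End_ringP. Qed.
Fact End_mul1 : left_id End_one End_mul.
Proof. by move=> f; apply: End_ringP. Qed.
Fact End_mulr1 : right_id End_one End_mul.
Proof. by move=> f; apply: End_ringP. Qed.
Fact End_mulDl : left_distributive End_mul End_add.
Proof. by move=> f g h; apply: End_ringP. Qed.
Fact End_mulDr : right_distributive End_mul End_add.
Proof. by move=> f g h; apply: End_ringP => v; rewrite /= linearD. Qed.

HB.instance Definition _ :=
  GRing.isZmodule.Build E End_addA End_addC End_add0 End_addN.
HB.instance Definition _ := GRing.Zmodule_isPzRing.Build E
  End_mulA End_mul1 End_mulr1 End_mulDl End_mulDr.

End EndRing.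

Definition is_projective (R : pzRingType) (P : lmodType R) : Prop :=
  forall (M N : lmodType R) (g : {linear M -> N}) (f : {linear P -> N}),
    (forall y, exists x, g x = y) ->
    exists h : {linear P -> M}, forall x, g (h x) = f x.

(* M has a projective resolution 0 -> P_n -> ... -> P_0 -> M -> 0. *)
Definition pd_le (R : pzRingType) (M : lmodType R) (n : nat) : Prop :=
  exists (P : nat -> lmodType R)
         (d : forall i, {linear P i.+1 -> P i}) (e : {linear P 0%N -> M}),
    [/\ forall i, is_projective (P i),
        forall y, exists x, e x = y,
        forall x, e x = 0 <-> exists y, d 0%N y = x,
        forall i x, d i x = 0 <-> exists y, d i.+1 y = x
      & forall i, (n < i)%N -> forall x : P i, x = 0].

Definition gldim_le (R : pzRingType) (n : nat) : Prop :=
  forall M : lmodType R, pd_le M n.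

(* [lmodType] provides left modules, so this is the left global dimension; the
   left and right ones agree for two-sided Noetherian rings, among them the
   endomorphism rings of finitely generated modules over a commutative
   Noetherian ring. *)
Definition is_gldim (R : pzRingType) (n : nat) : Prop :=
  gldim_le R n /\ forall m, gldim_le R m -> (n <= m)%N.

Definition is_krull_dim (R : comNzRingType) (n : nat) : Prop :=
  let prime_chain m := exists p : nat -> prime_idealr R,
    forall i, (i < m)%N ->
      {subset p i <= p i.+1} /\ ~ {subset p i.+1 <= p i} in
  prime_chain n /\ forall m, prime_chain m -> (m <= n)%N.

Definition fin_gen (R : pzRingType) (M : lmodType R) : Prop :=
  exists (n : nat) (g : 'I_n -> M),
    forall v, exists a : 'I_n -> R, v = \sum_i a i *: g i.

(* For R commutative, the submodule (s)M of M. *)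
Definition seq_smul (R : pzRingType) (M : lmodType R) (s : seq R) : set M :=
  [set v | exists w : nat -> M, v = \sum_(i < size s) s`_i *: w i].

Arguments seq_smul {R} M s.

Definition regular_seq (R : pzRingType) (M : lmodType R) (s : seq R) : Prop :=
  (forall i, (i < size s)%N -> forall v : M,
     seq_smul M (take i s) (s`_i *: v) -> seq_smul M (take i s) v)
  /\ exists v : M, ~ seq_smul M s v.

Arguments regular_seq {R} M s.

(* For a local ring, its maximal ideal. *)
Definition nonunits (R : pzRingType) : set R :=
  [set a | ~ exists b, b * a = 1].

(* For a local ring R, the depth of M. *)
Definition is_depth (R : pzRingType) (M : lmodType R) (n : nat) : Prop :=
  let M_seq (s : seq R) :=
    (forall a, a \in s -> nonunits a) /\ regular_seq M s in
  (exists2 s, M_seq s & size s = n) /\ forall s, M_seq s -> (size s <= n)%N.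

(* For a local ring R, maximal Cohen-Macaulay modules are the nonzero finitely
   generated M with depth M = dim R. *)
Definition is_MCM (R : comNzRingType) (M : lmodType R) : Prop :=
  [/\ fin_gen M, exists v : M, v != 0
    & exists2 n, is_depth M n & is_krull_dim R n].

(* [is_MCM] is the definition for local rings, so this is the global spectrum
   of a local Cohen-Macaulay ring R. *)
Definition global_spectrum (R : comNzRingType) : set nat :=
  [set n | exists2 M : lmodType R, is_MCM M & is_gldim (End_ring M) n].

(* Main.v *)
(* The substitution x = - t^2, y = t^3 identifies R with the power series in
   S = k[[t]] without linear term, so that m = t^2 S is both the maximal ideal of
   R and the conductor. A finitely generated module M on which t^2 is injective
   is a direct sum of copies of R and S: among the minimal families in M that
   generate the S-module S M, take one with as many members f as possible
   satisfying t f in M.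

   Let E = End_R(M), let L = Hom_R(S, M) = {v in M | t v in M}, and let K be a
   syzygy of an E-module, i.e. a submodule of a free one. If S is a summand of M,
   with idempotent e, then e K is a free module over S = e E e, and its basis
   yields an injection L^(C) -> K. It is onto if M = S^b, so then gldim E <= 1.
   If R is a summand too, its cokernel is, up to Morita equivalence, a k-vector
   space, and a basis of it yields a resolution
   0 -> L^(D) -> L^(C) x M^(D) -> K -> 0, so gldim E <= 2.

   Conversely m M is not E-projective as soon as R is a summand of M, so that
   M / m M has projective dimension at least 2. If M is free, m M is moreover its
   own first syzygy under M^2 -> m M, and gldim E is infinite. The global
   dimension is never 0: E / E a is not projective for a nonunit a of R that is
   regular on M. *)
From HB Require Import structures.
Require Import Defs.
From mathcomp Require Import all_boot all_order all_algebra.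
From mathcomp Require Import ring_quotient generic_quotient zify ring.
From mathcomp Require Import boolp classical_sets wochoice.

Set Implicit Arguments.
Unset Strict Implicit.
Unset Printing Implicit Defensive.

Import GRing.Theory.
Local Open Scope ring_scope.
Local Open Scope quotient_scope.

(** * Projective dimension *)

(** Global dimension quantifies over all E-modules, so K sits in a free module of arbitrary rank,
    and the freeness of e K over the discrete valuation ring S is obtained from leading terms along
    a well-order of the coordinates. The same argument, made relative to a subgroup, yields the
    basis of the cokernel. That cokernel is a k-vector space because m is the conductor: if e' is
    the projection onto a summand R, multiplication by t^2 s on e' K factors as e' K -> e K -> e' K,
    through the inclusion of R in S followed by the map t^2 s from S to R. So m e' K already lies in
    the image of L^(C). The kernel is L^(D) because M / L is the residue field on each summand R and
    zero on each summand S: an element of M^(D) whose image already comes from L^(C) has all its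
    R-coordinates in m. *)

Definition mklin (R : pzRingType) (U V : lmodType R) (f : U -> V)
  (flin : linear f) : {linear U -> V} :=
  HB.pack f (GRing.isLinear.Build R U V *:%R f flin).

Lemma mklinE (R : pzRingType) (U V : lmodType R) (f : U -> V)
  (flin : linear f) v : mklin flin v = f v.
Proof. by []. Qed.

Record submodule (R : pzRingType) (V : lmodType R) := Submodule {
  sub_set :> V -> Prop;
  sub_set0 : sub_set 0;
  sub_setP : forall a u v, sub_set u -> sub_set v -> sub_set (a *: u + v) }.

Section Submodule.
Variables (R : pzRingType) (V : lmodType R) (W : submodule V).

Lemma sub_setD u v : W u -> W v -> W (u + v).
Proof. by move=> Wu Wv; rewrite -[u]scale1r; apply: sub_setP. Qed.

Lemma sub_setZ a v : W v -> W (a *: v).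
Proof. by move=> Wv; rewrite -[_ *: _]addr0; apply: sub_setP => //; exact: sub_set0. Qed.

Lemma sub_setN v : W v -> W (- v).
Proof. by move=> Wv; rewrite -scaleN1r; exact: sub_setZ. Qed.

Lemma sub_setB u v : W u -> W v -> W (u - v).
Proof. by move=> Wu Wv; apply: sub_setD => //; exact: sub_setN. Qed.

Record smod := Smod { smval : V; smvalP : W smval }.

HB.instance Definition _ := gen_eqMixin smod.
HB.instance Definition _ := gen_choiceMixin smod.

Lemma smval_inj : injective smval.
Proof.
by case=> [u Wu] [v Wv] /= euv; case: v / euv Wv => Wv; rewrite (Prop_irrelevance Wu Wv).
Qed.

Let add (u v : smod) := Smod (sub_setD (smvalP u) (smvalP v)).
Let opp (u : smod) := Smod (sub_setN (smvalP u)).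
Let scale a (u : smod) := Smod (sub_setZ a (smvalP u)).

Fact smod_addA : associative add.
Proof. by move=> u v w; apply: smval_inj; rewrite /= addrA. Qed.
Fact smod_addC : commutative add.
Proof. by move=> u v; apply: smval_inj; rewrite /= addrC. Qed.
Fact smod_add0 : left_id (Smod (sub_set0 W)) add.
Proof. by move=> u; apply: smval_inj; rewrite /= add0r. Qed.
Fact smod_addN : left_inverse (Smod (sub_set0 W)) opp add.
Proof. by move=> u; apply: smval_inj; rewrite /= addNr. Qed.
HB.instance Definition _ :=
  GRing.isZmodule.Build smod smod_addA smod_addC smod_add0 smod_addN.

Fact smod_scaleA a b u : scale a (scale b u) = scale (a * b) u.
Proof. by apply: smval_inj; rewrite /= scalerA. Qed.
Fact smod_scale1 : left_id 1 scale.
Proof. by move=> u; apply: smval_inj; rewrite /= scale1r. Qed.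
Fact smod_scaleDr : right_distributive scale +%R.
Proof. by move=> a u v; apply: smval_inj; rewrite /= scalerDr. Qed.
Fact smod_scaleDl u : {morph scale^~ u : a b / a + b}.
Proof. by move=> a b; apply: smval_inj; rewrite /= scalerDl. Qed.
HB.instance Definition _ := GRing.Zmodule_isLmodule.Build R smod
  smod_scaleA smod_scale1 smod_scaleDr smod_scaleDl.

Fact smval_linear : linear smval. Proof. by []. Qed.
HB.instance Definition _ := GRing.isLinear.Build R smod V *:%R smval smval_linear.

(** Boolean form of [W], as the quotient of additive groups expects it; the scalar action is added
    to that quotient below. *)
Definition sub_pred : {pred V} := fun v => `[< W v >].

Fact sub_pred_closed : zmod_closed sub_pred.
Proof.
split=> [|u v /asboolP Wu /asboolP Wv]; apply/asboolP; first exact: sub_set0.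
exact: sub_setB.
Qed.
HB.instance Definition _ := GRing.isZmodClosed.Build V sub_pred sub_pred_closed.

Definition qmod : Type := Quotient.quot sub_pred.
HB.instance Definition _ := GRing.Zmodule.on qmod.

Definition qproj (v : V) : qmod := \pi_(Quotient.quot sub_pred) v.

Lemma qproj_eq u v : qproj u = qproj v <-> W (u - v).
Proof.
split.
  by move=> /eqP; rewrite /qproj -Quotient.idealrBE => /asboolP.
by move=> Wuv; apply/eqP; rewrite /qproj -Quotient.idealrBE; apply/asboolP.
Qed.

Lemma qproj_surj x : exists v, qproj v = x.
Proof. by exists (repr x); rewrite /qproj reprK. Qed.

Lemma qprojD u v : qproj (u + v) = qproj u + qproj v.
Proof. by rewrite /qproj [LHS]raddfD. Qed.

Definition qscale a (x : qmod) : qmod := qproj (a *: repr x).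

Lemma qscaleE a v : qscale a (qproj v) = qproj (a *: v).
Proof.
apply/qproj_eq; rewrite -scalerBr; apply: sub_setZ.
by apply/qproj_eq; rewrite /qproj reprK.
Qed.

Fact qmod_scaleA a b u : qscale a (qscale b u) = qscale (a * b) u.
Proof. by case: (qproj_surj u) => v <-; rewrite !qscaleE scalerA. Qed.
Fact qmod_scale1 : left_id 1 qscale.
Proof. by move=> u; case: (qproj_surj u) => v <-; rewrite !qscaleE scale1r. Qed.
Fact qmod_scaleDr : right_distributive qscale +%R.
Proof.
move=> a u u'; case: (qproj_surj u) => v <-; case: (qproj_surj u') => v' <-.
by rewrite -qprojD !qscaleE scalerDr qprojD.
Qed.
Fact qmod_scaleDl u : {morph qscale^~ u : a b / a + b}.
Proof. by move=> a b; case: (qproj_surj u) => v <-; rewrite !qscaleE scalerDl qprojD. Qed.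
HB.instance Definition _ := GRing.Zmodule_isLmodule.Build R qmod
  qmod_scaleA qmod_scale1 qmod_scaleDr qmod_scaleDl.

Fact qproj_linear : linear qproj.
Proof. by move=> a u v; rewrite qprojD -qscaleE. Qed.
HB.instance Definition _ := GRing.isLinear.Build R V qmod *:%R qproj qproj_linear.

End Submodule.

Section Kernel.
Variables (R : pzRingType) (U V : lmodType R) (f : {linear U -> V}).

Definition kerm : submodule U.
Proof.
exists (fun u => f u = 0) => /= [|a u v fu fv]; first by rewrite linear0.
by rewrite linearP fu fv scaler0 addr0.
Defined.

Definition limage : submodule V.
Proof.
exists (fun v => exists u, f u = v) => [|a u v [x <-] [y <-]].
  by exists 0; rewrite linear0.
by exists (a *: x + y); rewrite linearP.
Defined.

End Kernel.

Lemma smod_lift (R : pzRingType) (U V : lmodType R) (W : submodule V)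
  (f : {linear U -> V}) : (forall u, W (f u)) ->
  exists g : {linear U -> smod W}, forall u, smval (g u) = f u.
Proof.
move=> Wf.
have glin : linear (fun u => Smod (Wf u)).
  by move=> a u v; apply: smval_inj; rewrite /= linearP.
by exists (mklin glin).
Qed.

(** Preimages under an injective map are unique, so any choice of them is linear. This produces
    every map into a kernel or syzygy below. *)
Lemma lin_factor (R : pzRingType) (U V K : lmodType R)
  (i : {linear K -> V}) (f : {linear U -> V}) :
  injective i -> (forall u, exists x, i x = f u) ->
  exists g : {linear U -> K}, forall u, i (g u) = f u.
Proof.
move=> iinj fi; have [g gP] := choice fi.
have glin : linear g.
  by move=> a u v; apply: iinj; rewrite linearP !gP linearP.
by exists (mklin glin).
Qed.

Section Exact.
Variable R : pzRingType.
Implicit Types K P X Y : lmodType R.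

Definition short_exact K P X (i : {linear K -> P}) (p : {linear P -> X}) :=
  [/\ injective i, forall x, exists y, p y = x
    & forall y, p y = 0 <-> exists z, i z = y].

Lemma ker_exact P X (p : {linear P -> X}) : (forall x, exists y, p y = x) ->
  short_exact (@smval _ _ (kerm p)) p.
Proof.
move=> psurj; split=> // [|y]; first exact: smval_inj.
split=> [py|[[z pz] <-] //]; by exists (Smod (py : kerm p y)).
Qed.

Lemma projective_retract X P (f : {linear X -> P}) (g : {linear P -> X}) :
  cancel f g -> is_projective P -> is_projective X.
Proof.
move=> fK Pproj M N s h ssurj.
have [l lP] := Pproj M N s [the {linear P -> N} of h \o g] ssurj.
by exists [the {linear X -> M} of l \o f] => x; rewrite /= lP /= fK.
Qed.

Lemma projective_prod P Q : is_projective P -> is_projective Q ->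
  is_projective (P * Q)%type.
Proof.
move=> Pproj Qproj M N s h ssurj.
have inl_lin : linear (fun x : P => (x, 0) : P * Q).
  by move=> a x y; congr pair; rewrite /= scaler0 addr0.
have inr_lin : linear (fun x : Q => (0, x) : P * Q).
  by move=> a x y; congr pair; rewrite /= scaler0 addr0.
have [l lP] := Pproj M N s [the {linear P -> N} of h \o mklin inl_lin] ssurj.
have [l' lP'] := Qproj M N s [the {linear Q -> N} of h \o mklin inr_lin] ssurj.
have klin : linear (fun x : P * Q => l x.1 + l' x.2).
  by move=> a x y /=; rewrite !linearP scalerDr addrACA.
exists (mklin klin) => -[x y]; rewrite mklinE linearD lP lP' /= -linearD.
by congr (h _); congr pair; rewrite /= ?addr0 ?add0r.
Qed.

Lemma projective_regular : is_projective R^o.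
Proof.
move=> M N s h ssurj; have [m mP] := ssurj (h 1).
have llin : linear (fun x : R^o => x *: m).
  by move=> a x y; rewrite scalerDl scalerA.
exists (mklin llin) => x; rewrite mklinE linearZ mP -linearZ.
by congr (h _); exact: mulr1.
Qed.

Definition trivial_submodule X : submodule X.
Proof.
by exists (fun u => u = 0) => //= a u v -> ->; rewrite scaler0 addr0.
Defined.

Definition zero_module : lmodType R := smod (trivial_submodule R^o).

Lemma zero_moduleP (x : zero_module) : x = 0.
Proof. by apply: smval_inj; case: x. Qed.

Lemma projective_zero X : (forall x : X, x = 0) -> is_projective X.
Proof.
move=> X0 M N s h _.
have zlin : linear (fun _ : X => 0 : M) by move=> a x y; rewrite scaler0 addr0.
by exists (mklin zlin) => x; rewrite mklinE (X0 x) !linear0.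
Qed.

Lemma pd_le0 X : pd_le X 0 <-> is_projective X.
Proof.
split=> [[P [d [e [Pproj esurj kere _ P0]]]]|Xproj].
  have einj : injective e.
    move=> x y exy; apply/eqP; rewrite -subr_eq0; apply/eqP.
    have /kere[z <-] : e (x - y) = 0 by rewrite linearB exy subrr.
    by rewrite (P0 1%N _ z) // linear0.
  have [g gP] := @lin_factor _ X X (P 0%N) e [the {linear _ -> _} of idfun] einj esurj.
  exact: (projective_retract gP).
pose P i := if i is 0%N then X else zero_module.
have zlin i : linear (fun _ : P i.+1 => 0 : P i) by move=> a x y; rewrite scaler0 addr0.
exists P, (fun i => mklin (zlin i)), [the {linear X -> X} of idfun].
split=> [[|i] //=|y|x|i x|[|i] //= _ x].
- exact/projective_zero/zero_moduleP.
- by exists y.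
- by split=> [x0|[y <-] //]; exists 0; rewrite linear0 -x0.
- by split=> // _; exists 0; rewrite [RHS]zero_moduleP mklinE.
- exact: zero_moduleP.
Qed.

(** Cuts a resolution at P_0, or splices one onto a short exact sequence. Together with [pd_le0] it
    replaces resolutions by induction on short exact sequences. *)
Lemma pd_leS X n : pd_le X n.+1 <->
  exists K P (i : {linear K -> P}) (p : {linear P -> X}),
    [/\ is_projective P, short_exact i p & pd_le K n].
Proof.
split=> [[P [d [e [Pproj esurj kere kerd P0]]]]|].
  exists (smod (kerm e)), (P 0%N), (@smval _ _ (kerm e)), e.
  split=> //; first exact: ker_exact.
  have [|q qP] := @smod_lift _ _ _ (kerm e) (d 0%N).
    by move=> u; apply/kere; exists u.
  exists (fun i => P i.+1), (fun i => d i.+1), q.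
  split=> [i|[y ey]|x|i x|i lt_ni x] //.
  - have /kere[z zP] := ey; exists z; apply: smval_inj; by rewrite qP.
  - have qd : q x = 0 <-> d 0%N x = 0.
      rewrite -qP; split=> [->|qx0]; first by rewrite linear0.
      exact: smval_inj.
    by rewrite qd; exact: kerd.
  - exact: (P0 i.+1).
move=> [K [P [i [p [Pproj [iinj psurj kerp] [Q [d [e [Qproj esurj kere kerd Q0]]]]]]]]].
pose P' j := if j is j'.+1 then Q j' else P.
pose d' j : {linear P' j.+1 -> P' j} :=
  match j return {linear P' j.+1 -> P' j} with
  | 0%N => [the {linear Q 0%N -> P} of i \o e]
  | j'.+1 => d j' end.
exists P', d', p; split=> [[|j] //|//|x|[|j] x|[|j] //= lt_nj x].
- exact: (Qproj j).
- split=> [/kerp[z <-]|[y yx]].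
    by have [y <-] := esurj z; exists y.
  by apply/kerp; exists (e y); exact: yx.
- have ie : i (e x) = 0 <-> e x = 0.
    split=> [iex|->]; last by rewrite linear0.
    by apply: iinj; rewrite iex linear0.
  by rewrite /= ie; exact: kere.
- exact: (kerd j).
- exact: (Q0 j).
Qed.

(* X is a direct summand of Y up to projectives. *)
Definition stable_retract X Y :=
  exists (f : {linear X -> Y}) (g : {linear Y -> X}) (Q : lmodType R)
         (a : {linear X -> Q}) (b : {linear Q -> X}),
    is_projective Q /\ forall x, x = g (f x) + b (a x).

Lemma stable_retract_refl X : stable_retract X X.
Proof.
have zlin : linear (fun _ : X => 0 : X) by move=> c x y; rewrite scaler0 addr0.
have zlin' : linear (fun _ : X => 0 : zero_module) by move=> c x y; rewrite scaler0 addr0.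
have zlin'' : linear (fun _ : zero_module => 0 : X).
  by move=> c x y; rewrite scaler0 addr0.
exists [the {linear X -> X} of idfun], [the {linear X -> X} of idfun].
exists zero_module, (mklin zlin'), (mklin zlin''); split=> [|x].
  exact/projective_zero/zero_moduleP.
by rewrite /= addr0.
Qed.

Lemma stable_retract_projective X Y :
  stable_retract X Y -> is_projective Y -> is_projective X.
Proof.
move=> [f [g [Q [a [b [Qproj E]]]]]] Yproj.
have flin : linear (fun x => (f x, a x)) by move=> c x y; rewrite !linearP.
have glin : linear (fun x : Y * Q => g x.1 + b x.2).
  by move=> c x y /=; rewrite !linearP scalerDr addrACA.
apply: (@projective_retract _ (Y * Q)%type (mklin flin) (mklin glin)).
  by move=> x; rewrite !mklinE /= -E.
exact: projective_prod.
Qed.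

(* Replaces the comparison of whole resolutions, and Schanuel's lemma. *)
Lemma stable_retract_syzygy X Y K P (L P' : lmodType R)
    (i : {linear K -> P}) (p : {linear P -> X})
    (j : {linear L -> P'}) (q : {linear P' -> Y}) :
  short_exact i p -> short_exact j q -> is_projective P -> is_projective P' ->
  stable_retract X Y -> stable_retract K L.
Proof.
move=> [iinj psurj kerp] [jinj qsurj kerq] Pproj P'proj.
move=> [f [g [Q [a [b [Qproj E]]]]]].
have [f' f'P] := Pproj _ _ q [the {linear _ -> _} of f \o p] qsurj.
have [g' g'P] := P'proj _ _ p [the {linear _ -> _} of g \o q] psurj.
have [b' b'P] := Qproj _ _ p b psurj.
have pi0 z : p (i z) = 0 by apply/kerp; exists z.
have qj0 z : q (j z) = 0 by apply/kerq; exists z.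
have [F FP] : exists F : {linear K -> L}, forall z, j (F z) = f' (i z).
  apply: (@lin_factor _ _ _ _ j [the {linear _ -> _} of f' \o i]) => // z.
  by apply/kerq; rewrite /= f'P /= pi0 linear0.
have [G GP] : exists G : {linear L -> K}, forall z, i (G z) = g' (j z).
  apply: (@lin_factor _ _ _ _ i [the {linear _ -> _} of g' \o j]) => // z.
  by apply/kerp; rewrite /= g'P /= qj0 linear0.
(* Since the identity of X is g f + b a, this difference of lifts is killed by [p] and lands in K.
   On K the last term vanishes, so the identity of K is G F plus a map that factors through P. *)
have hlin : linear (fun x => x - g' (f' x) - b' (a (p x))).
  by move=> c x y; rewrite !linearP /= !scalerDr !addrA (ACl (1*3*5*2*4*6)).
have [H HP] : exists H : {linear P -> K}, forall x,
    i (H x) = x - g' (f' x) - b' (a (p x)).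
  apply: (@lin_factor _ _ _ _ i (mklin hlin)) => // x.
  apply/kerp; rewrite mklinE !linearB /= g'P b'P /= f'P /=.
  by rewrite {1}[p x]E addrAC addrK subrr.
exists F, G, P, i, H; split=> // z; apply: iinj.
by rewrite linearD HP GP FP pi0 !linear0 addr0 addrC subrK.
Qed.

End Exact.

(** * Direct sums and filtered bases *)

Section DirectSum.
Variables (R : pzRingType) (C : eqType) (Z : lmodType R).

(** Finiteness of the support is a proposition and not a stored list, so that pointwise equal
    families are equal. *)
Record dsum := Dsum {
  dsum_fun :> C -> Z;
  dsum_finite : exists s : seq C, forall c, dsum_fun c <> 0 -> c \in s }.

HB.instance Definition _ := gen_eqMixin dsum.
HB.instance Definition _ := gen_choiceMixin dsum.

Lemma dsumP (f g : dsum) : f =1 g -> f = g.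
Proof.
case: f g => [f ff] [g gf] /= /funext efg.
by case: g / efg gf => gf; rewrite (Prop_irrelevance ff gf).
Qed.

Fact dsum0_finite : exists s : seq C, forall c, (0 : Z) <> 0 -> c \in s.
Proof. by exists [::]. Qed.

Fact dsumD_finite (f g : dsum) :
  exists s : seq C, forall c, f c + g c <> 0 -> c \in s.
Proof.
have [[s sP] [t tP]] := (dsum_finite f, dsum_finite g).
exists (s ++ t) => c fg0; rewrite mem_cat; apply/orP.
have [fc0|fcN0] := eqVneq (f c) 0; last by left; apply/sP/eqP.
by right; apply: tP => gc0; apply: fg0; rewrite fc0 gc0 addr0.
Qed.

Fact dsumN_finite (f : dsum) : exists s : seq C, forall c, - f c <> 0 -> c \in s.
Proof.
have [s sP] := dsum_finite f; exists s => c fc; apply: sP => fc0.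
by apply: fc; rewrite fc0 oppr0.
Qed.

Fact dsumZ_finite a (f : dsum) :
  exists s : seq C, forall c, a *: f c <> 0 -> c \in s.
Proof.
have [s sP] := dsum_finite f; exists s => c fc; apply: sP => fc0.
by apply: fc; rewrite fc0 scaler0.
Qed.

Let zero := Dsum dsum0_finite.
Let add f g := Dsum (dsumD_finite f g).
Let opp f := Dsum (dsumN_finite f).
Let scale a f := Dsum (dsumZ_finite a f).

Fact dsum_addA : associative add.
Proof. by move=> f g h; apply: dsumP => c /=; rewrite addrA. Qed.
Fact dsum_addC : commutative add.
Proof. by move=> f g; apply: dsumP => c /=; rewrite addrC. Qed.
Fact dsum_add0 : left_id zero add.
Proof. by move=> f; apply: dsumP => c /=; rewrite add0r. Qed.
Fact dsum_addN : left_inverse zero opp add.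
Proof. by move=> f; apply: dsumP => c /=; rewrite addNr. Qed.
HB.instance Definition _ :=
  GRing.isZmodule.Build dsum dsum_addA dsum_addC dsum_add0 dsum_addN.

Fact dsum_scaleA a b f : scale a (scale b f) = scale (a * b) f.
Proof. by apply: dsumP => c /=; rewrite scalerA. Qed.
Fact dsum_scale1 : left_id 1 scale.
Proof. by move=> f; apply: dsumP => c /=; rewrite scale1r. Qed.
Fact dsum_scaleDr : right_distributive scale +%R.
Proof. by move=> a f g; apply: dsumP => c /=; rewrite scalerDr. Qed.
Fact dsum_scaleDl f : {morph scale^~ f : a b / a + b}.
Proof. by move=> a b; apply: dsumP => c /=; rewrite scalerDl. Qed.
HB.instance Definition _ := GRing.Zmodule_isLmodule.Build R dsum
  dsum_scaleA dsum_scale1 dsum_scaleDr dsum_scaleDl.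

Lemma dsumDE (f g : dsum) c : (f + g) c = f c + g c. Proof. by []. Qed.
Lemma dsumBE (f g : dsum) c : (f - g) c = f c - g c. Proof. by []. Qed.
Lemma dsumZE a (f : dsum) c : (a *: f) c = a *: f c. Proof. by []. Qed.
Fact single_finite c z :
  exists s : seq C, forall d, (if d == c then z else 0 : Z) <> 0 -> d \in s.
Proof. by exists [:: c] => d; rewrite inE; case: (d == c). Qed.

Definition single c z := Dsum (single_finite c z).

Lemma singleE c z d : single c z d = if d == c then z else 0. Proof. by []. Qed.

Definition dsupp (f : dsum) : seq C := undup (sval (cid (dsum_finite f))).

Lemma dsupp_uniq f : uniq (dsupp f).
Proof. exact: undup_uniq. Qed.

Lemma mem_dsupp (f : dsum) c : f c <> 0 -> c \in dsupp f.
Proof. by move=> fc; rewrite mem_undup; case: cid => s /= sP; exact: sP. Qed.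

Section Sum.
Variables (Y : zmodType) (h : C -> Z -> Y).

Definition dsum_ext (f : dsum) := \sum_(c <- dsupp f) h c (f c).

Hypothesis hD : forall c x y, h c (x + y) = h c x + h c y.

Let h0 c : h c 0 = 0.
Proof. by apply: (addrI (h c 0)); rewrite -hD !addr0. Qed.

(** [dsupp] is an arbitrary choice of list; as [h c] is additive, zero entries contribute nothing
    and any list that contains the support gives the same sum. *)
Lemma dsum_extE (f : dsum) s : uniq s -> (forall c, f c <> 0 -> c \in s) ->
  dsum_ext f = \sum_(c <- s) h c (f c).
Proof.
move=> s_uniq sP.
have red t : \sum_(c <- t) h c (f c) = \sum_(c <- t | f c != 0) h c (f c).
  rewrite [RHS]big_mkcond; apply: eq_bigr => c _.
  by case: eqVneq => //= ->; rewrite h0.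
rewrite /dsum_ext red [RHS]red -!(big_filter _ (fun c => f c != 0)).
apply: perm_big; apply: uniq_perm; rewrite ?filter_uniq ?dsupp_uniq // => c.
rewrite !mem_filter; case: eqP => //= fc.
by rewrite sP // mem_dsupp.
Qed.

Lemma dsum_extD : {morph dsum_ext : f g / f + g}.
Proof.
move=> f g; pose s := undup (dsupp f ++ dsupp g).
have s_uniq : uniq s := undup_uniq _.
have fs c : f c <> 0 -> c \in s.
  by move=> fc; rewrite mem_undup mem_cat mem_dsupp.
have gs c : g c <> 0 -> c \in s.
  by move=> gc; rewrite mem_undup mem_cat orbC mem_dsupp.
rewrite !(dsum_extE s_uniq) //; last first.
  move=> c; have [fc0|/eqP/fs//] := eqVneq (f c) 0.
  by rewrite dsumDE fc0 add0r; exact: gs.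
by rewrite -big_split; apply: eq_bigr => c _ /=; rewrite -hD.
Qed.

Lemma dsum_ext0 : dsum_ext 0 = 0.
Proof. by rewrite /dsum_ext big1 // => c _; exact: h0. Qed.

Lemma dsum_ext_single c z : dsum_ext (single c z) = h c z.
Proof.
rewrite (@dsum_extE _ [:: c]) // => [|d]; rewrite ?big_seq1 singleE ?eqxx //.
by rewrite inE; case: (d == c).
Qed.

End Sum.

Lemma eq_dsum_ext (Y : zmodType) (h h' : C -> Z -> Y) (f : dsum) :
  (forall c, h c (f c) = h' c (f c)) -> dsum_ext h f = dsum_ext h' f.
Proof. by move=> hh'; apply: eq_bigr => c _. Qed.

Lemma dsum_ext_morph (Y Y' : zmodType) (h : C -> Z -> Y) (F : Y -> Y') (f : dsum) :
  (forall x y, F (x + y) = F x + F y) -> F 0 = 0 ->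
  F (dsum_ext h f) = dsum_ext (fun c z => F (h c z)) f.
Proof. by move=> FD F0; rewrite /dsum_ext; elim/big_ind2: _ => // ? ? ? ? <- <-. Qed.

Lemma dsum_ext_linear (Y : lmodType R) (h : C -> {linear Z -> Y}) :
  linear (dsum_ext h).
Proof.
move=> a f g; rewrite dsum_extD; last by move=> c x y; rewrite linearD.
congr (_ + _); rewrite (@dsum_extE _ _ _ _ (dsupp f)) ?dsupp_uniq //.
- by rewrite scaler_sumr; apply: eq_bigr => c _; rewrite -linearZ.
- by move=> c x y; rewrite linearD.
- move=> c afc; apply: mem_dsupp => fc0; apply: afc.
  by rewrite dsumZE fc0 scaler0.
Qed.

Fact single_linear c : linear (single c).
Proof.
move=> a x y; apply: dsumP => d; rewrite dsumDE dsumZE !singleE.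
by case: (d == c); rewrite // scaler0 addr0.
Qed.

Lemma dsum_sum_single f : f = dsum_ext single f.
Proof.
apply: dsumP => d; rewrite /dsum_ext.
transitivity (\sum_(c <- dsupp f) single c (f c) d).
  have [ds|dNs] := boolP (d \in dsupp f).
    rewrite (bigD1_seq d) ?dsupp_uniq //= eqxx big1 ?addr0 // => c /negPf.
    by rewrite eq_sym => ->.
  rewrite big1_seq => [|c /andP[_ cs]]; last first.
    by rewrite singleE; case: eqVneq => // dc; rewrite dc cs in dNs.
  by apply/eqP; apply: contraNT dNs => /eqP; exact: mem_dsupp.
by elim/big_ind2: _ => // ? f1 ? f2 -> ->.
Qed.

Lemma projective_dsum : is_projective Z -> is_projective dsum.
Proof.
move=> Zproj M N s h ssurj.
have /choice[l lP] c : exists l : {linear Z -> M},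
    forall z, s (l z) = h (single c z).
  exact: (Zproj M N s [the {linear Z -> N} of h \o mklin (single_linear c)]).
exists (mklin (dsum_ext_linear l)) => f; rewrite mklinE.
rewrite (@dsum_ext_morph _ _ _ s) ?linear0 //; last exact: linearD.
rewrite {2}[f]dsum_sum_single (@dsum_ext_morph _ _ _ h) ?linear0 //.
  by apply: eq_dsum_ext => c; rewrite lP.
exact: linearD.
Qed.

End DirectSum.

Lemma free_cover (R : pzRingType) (N : lmodType R) :
  exists p : {linear dsum N R^o -> N}, forall x, exists f, p f = x.
Proof.
have hlin (x : N) : linear (fun a : R^o => (a : R) *: x).
  by move=> a b c; rewrite scalerDl scalerA.
exists (mklin (dsum_ext_linear (fun x => mklin (hlin x)))) => x.
exists (single x (1 : R^o)); rewrite mklinE dsum_ext_single; first exact: scale1r.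
by move=> y a b; rewrite linearD.
Qed.

Section DirectSumMap.
Variables (R R' : pzRingType) (C : eqType) (Z : lmodType R) (Z' : lmodType R').

Fact dmap_finite (p : Z -> Z') (f : dsum C Z) (p0 : p 0 = 0) :
  exists s : seq C, forall c, p (f c) <> 0 -> c \in s.
Proof.
by have [s sP] := dsum_finite f; exists s => c pfc; apply: sP => fc0; rewrite fc0 in pfc.
Qed.

(** Only p 0 = 0 is required, because the maps used here run between modules over different rings,
    such as S and L. *)
Definition dmap (p : Z -> Z') (p0 : p 0 = 0) (f : dsum C Z) : dsum C Z' :=
  Dsum (dmap_finite f p0).

Lemma dmapE p p0 f c : @dmap p p0 f c = p (f c). Proof. by []. Qed.

Lemma dsum_ext_map (Y : zmodType) (h : C -> Z' -> Y) p p0 f :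
  (forall c x y, h c (x + y) = h c x + h c y) ->
  dsum_ext h (@dmap p p0 f) = dsum_ext (fun c z => h c (p z)) f.
Proof.
move=> hD; rewrite (@dsum_extE _ _ _ _ h hD _ (dsupp f)) ?dsupp_uniq // => c.
by rewrite dmapE => pfc; apply: mem_dsupp => fc0; rewrite fc0 in pfc.
Qed.

End DirectSumMap.


(** Zermelo's theorem provides least elements. Applied to sets of two or three elements they give
    totality, antisymmetry and transitivity; applied to the set of counterexamples they give
    induction. *)
Lemma well_ordered_rel (T : eqType) : exists lt : rel T,
  [/\ irreflexive lt, transitive lt,
      forall x y, x != y -> lt x y \/ lt y x
    & forall P : T -> Prop, (forall x, (forall y, lt y x -> P y) -> P x) ->
        forall x, P x].
Proof.
have [le wo] := well_ordering_principle T.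
have min A : nonempty A -> exists z, minimum_of le A z.
  by move=> /wo[z [zA _]]; exists z.
have tot x y : le x y \/ le y x.
  have [|z [zA zmin]] := min [pred z | (z == x) || (z == y)].
    by exists x; rewrite inE eqxx.
  have := zmin x; have := zmin y; rewrite !inE !eqxx orbT => zy zx.
  by move: zA; rewrite inE => /orP[] /eqP ez; rewrite -ez; [left|right]; auto.
have anti x y : le x y -> le y x -> x = y.
  move=> xy yx; have [|z [_ zu]] := wo [pred z | (z == x) || (z == y)].
    by exists x; rewrite inE eqxx.
  have xx : le x x by case: (tot x x).
  have yy : le y y by case: (tot y y).
  rewrite -(zu x) ?(zu y) //; split; rewrite ?inE ?eqxx ?orbT // => w;
    by rewrite inE => /orP[] /eqP->.
have trans x y z : le x y -> le y z -> le x z.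
  move=> xy yz.
  have [|m [mA mmin]] := min [pred m | [|| m == x, m == y | m == z]].
    by exists x; rewrite inE eqxx.
  have := mmin x; have := mmin y; have := mmin z.
  rewrite !inE !eqxx !orbT => mz my mx.
  case/or3P: mA => /eqP em; rewrite em in mx my mz.
  - exact: mz.
  - by rewrite (anti _ _ xy (mx isT)).
  - by rewrite -(anti _ _ yz (my isT)).
exists (fun x y => le x y && (x != y)); split.
- by move=> x; rewrite eqxx andbF.
- move=> y x z /andP[xy nxy] /andP[yz nyz]; rewrite (trans _ _ _ xy yz) /=.
  by apply: contraNneq nyz => exz; rewrite -exz in yz *; rewrite (anti _ _ xy yz).
- move=> x y nxy; have [->|->] := tot x y; rewrite ?nxy; first by left.
  by right; rewrite eq_sym nxy.
move=> P Pind x; apply: contrapT => nPx.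
have [|z [/asboolP zA zmin]] := min (fun y => `[< ~ P y >]).
  by exists x; apply/asboolP.
apply: zA; apply: Pind => y /andP[yz nyz]; apply: contrapT => nPy.
have zy : le z y by apply: zmin; apply/asboolP.
by rewrite (anti _ _ yz zy) eqxx in nyz.
Qed.

Lemma seq_max (T : eqType) (lt : rel T) (s : seq T) : transitive lt ->
  (forall x y, x != y -> lt x y \/ lt y x) -> s != [::] ->
  exists2 m, m \in s & forall c, c \in s -> c != m -> lt c m.
Proof.
move=> tr tot; elim: s => // x s IHs _.
have [->|/IHs[m ms mmax]] := eqVneq s [::].
  by exists x => [|c]; rewrite inE // => ->.
have [exm|/tot[xm|mx]] := eqVneq x m.
- exists x => [|c]; rewrite inE ?eqxx // => /orP[->//|cs]; rewrite exm; exact: mmax.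
- exists m => [|c]; rewrite inE ?ms ?orbT // => /orP[/eqP->//|]; exact: mmax.
- exists x => [|c]; rewrite inE ?eqxx // => /orP[->//|cs _].
  have [->//|cm] := eqVneq c m; exact: tr (mmax c cs cm) mx.
Qed.

Section FilteredBasis.
Variables (A : pzRingType) (V : zmodType) (act : A -> V -> V).
Hypothesis actDl : forall a b v, act (a + b) v = act a v + act b v.

(** [act] is only assumed additive in the scalar: in both applications 1 acts on V as an idempotent
    of E and is the identity only on W. *)
Definition lincomb (C : eqType) (b : C -> V) (f : dsum C A^o) : V :=
  dsum_ext (fun (c : C) (a : A^o) => act a (b c)) f.

Variables (U W : V -> Prop) (T : eqType) (lt : rel T) (G : T -> V -> Prop).
Hypothesis U0 : U 0.
Hypothesis UB : forall u v, U u -> U v -> U (u - v).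
Hypothesis lt_trans : transitive lt.
Hypothesis lt_tot : forall x y, x != y -> lt x y \/ lt y x.
Hypothesis lt_wf : forall P : T -> Prop,
  (forall x, (forall y, lt y x -> P y) -> P x) -> forall x, P x.
Hypothesis GB : forall i u v, G i u -> G i v -> G i (u - v).
Hypothesis Gact : forall i a v, G i v -> G i (act a v).
Hypothesis UG : forall i v, U v -> G i v.
Hypothesis GW : forall i v, G i v -> W v.
Hypothesis Glt : forall i j v, lt i j -> G i v -> G j v.
Hypothesis WG : forall w, W w -> U w \/ exists i, G i w.

Definition lower i v := U v \/ exists2 j, lt j i & G j v.
Local Notation F := lower.

Hypothesis G_cyclic : forall i, (forall v, G i v -> F i v) \/
  exists b, [/\ G i b, forall v, G i v -> exists a, F i (v - act a b)
              & forall a, F i (act a b) -> a = 0].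

Lemma lowerB i u v : F i u -> F i v -> F i (u - v).
Proof.
have G0 j : G j 0 by apply: UG.
move=> [Uu|[j ji Gu]] [Uv|[l li Gv]].
- by left; exact: UB.
- by right; exists l => //; apply: GB => //; exact: UG.
- by right; exists j => //; apply: GB => //; exact: UG.
have [jl|/lt_tot[jl|lj]] := eqVneq j l.
- by right; exists l => //; apply: GB => //; rewrite -jl.
- by right; exists l => //; apply: GB => //; exact: Glt Gu.
- by right; exists j => //; apply: GB => //; exact: Glt Gv.
Qed.

(* The b c are leading terms: lower i is the part of the filtration G strictly
   below i, and G i is generated over it by at most one free element. *)
Lemma filtered_basis : exists (C : eqType) (b : C -> V),
  [/\ forall c, W (b c),
      forall w, W w -> exists f, U (w - lincomb b f)
    & forall f, U (lincomb b f) -> f = 0].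
Proof.
pose Q i b := [/\ G i b, forall v, G i v -> exists a, F i (v - act a b)
              & forall a, F i (act a b) -> a = 0].
pose p i := `[< exists b, Q i b >].
pose C : eqType := {i : T | p i}.
have /choice[b bQ] (c : C) : exists b, Q (val c) b by apply/asboolP/(valP c).
have act0 v : act 0 v = 0 by apply: (addrI (act 0 v)); rewrite -actDl !addr0.
have hD (c : C) (x y : A^o) : act (x + y) (b c) = act x (b c) + act y (b c).
  exact: actDl.
have UD u v : U u -> U v -> U (u + v).
  by move=> Uu Uv; rewrite -[v]opprK -[- v]add0r; do 2?apply: UB.
have spanF i v : (forall j, lt j i -> forall w, G j w -> exists f, U (w - lincomb b f)) ->
    F i v -> exists f, U (v - lincomb b f).
  move=> IH [Uv|[j ji Gv]]; last exact: (IH j ji).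
  by exists 0; rewrite /lincomb dsum_ext0 // subr0.
have spanG i v : G i v -> exists f, U (v - lincomb b f).
  elim/lt_wf: i v => i IH v Gv.
  have [Gi|Gi] := boolP (p i).
    have [_ /(_ v Gv)[a /(spanF i _ IH)[f fP]] _] := bQ (exist _ i Gi : C).
    exists (f + single (exist _ i Gi : C) (a : A^o)).
    by rewrite /lincomb dsum_extD // dsum_ext_single // opprD addrA addrAC.
  have [/(_ v Gv)|[c cQ]] := G_cyclic i; first exact: spanF.
  by case/negP: Gi; apply/asboolP; exists c.
exists C, b; split=> [c|w|f Uf].
- by have [/GW] := bQ c.
- move=> /WG[Uw|[i]]; last exact: spanG.
  by exists 0; rewrite /lincomb dsum_ext0 // subr0.
apply: contrapT => f0.
have ltC_trans : transitive (fun c d : C => lt (val c) (val d)).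
  by move=> y x z; exact: lt_trans.
have ltC_tot (c d : C) : c != d -> lt (val c) (val d) \/ lt (val d) (val c).
  by move=> cd; apply: lt_tot; apply: contraNneq cd => /val_inj ->.
pose s := [seq c <- dsupp f | f c != 0].
(* [m] is the largest index with a nonzero coefficient. The remaining terms lie in [lower (val m)],
   hence so does the term at [m], and freeness there gives [f m] = 0. *)
have [|m ms mmax] := @seq_max C _ s ltC_trans ltC_tot.
  apply: contra_notN f0 => /eqP s0; apply: dsumP => c; apply: contrapT => fc.
  have : c \in s by rewrite mem_filter mem_dsupp // andbT; apply/eqP.
  by rewrite s0.
have [Gm _ mfree] := bQ m.
move: ms; rewrite mem_filter => /andP[/eqP fm m_supp]; apply: fm; apply: mfree.
have -> : act (f m) (b m) =
    lincomb b f - \sum_(c <- dsupp f | c != m) act (f c) (b c).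
  by rewrite /lincomb /dsum_ext (bigD1_seq m) ?dsupp_uniq //= addrK.
have FU v : U v -> F (val m) v by left.
have FN v : F (val m) v -> F (val m) (- v) by rewrite -sub0r; apply: lowerB; exact: FU.
have FD u v : F (val m) u -> F (val m) v -> F (val m) (u + v).
  by move=> Fu Fv; rewrite -[v]opprK; apply: lowerB => //; exact: FN.
apply: lowerB; first exact: FU.
elim/big_ind: _ => [|//|c /= cm]; first exact: FU.
have [->|fc] := eqVneq (f c) 0; first by rewrite act0; exact: FU.
right; exists (val c); last by apply: Gact; have [] := bQ c.
apply: mmax; rewrite // mem_filter fc /=; exact/mem_dsupp/eqP.
Qed.

End FilteredBasis.

(** * The parametrization of the cusp by k[[t]] *)

Record fps (k : Type) := Fps { coef : nat -> k }.

HB.instance Definition _ (k : Type) := gen_eqMixin (fps k).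
HB.instance Definition _ (k : Type) := gen_choiceMixin (fps k).

Section PowerSeries.
Variable k : fieldType.
Implicit Types r s : fps k.

Lemma fpsP r s : coef r =1 coef s -> r = s.
Proof. by case: r s => [r] [s] /= /funext ->. Qed.

Let zero : fps k := Fps (fun _ => 0).
Let opp s : fps k := Fps (fun n => - coef s n).
Let add r s : fps k := Fps (fun n => coef r n + coef s n).
Let one : fps k := Fps (fun n => (n == 0%N)%:R).
Let mul r s : fps k := Fps (fun n => \sum_(i < n.+1) coef r i * coef s (n - i)).

Fact fps1_addA : associative add.
Proof. by move=> f g h; apply: fpsP => i /=; rewrite addrA. Qed.
Fact fps1_addC : commutative add.
Proof. by move=> f g; apply: fpsP => i /=; rewrite addrC. Qed.
Fact fps1_add0 : left_id zero add.
Proof. by move=> f; apply: fpsP => i /=; rewrite add0r. Qed.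
Fact fps1_addN : left_inverse zero opp add.
Proof. by move=> f; apply: fpsP => i /=; rewrite addNr. Qed.
HB.instance Definition _ :=
  GRing.isZmodule.Build (fps k) fps1_addA fps1_addC fps1_add0 fps1_addN.

(* The ring axioms are transported along the embedding f(t) |-> f(x). *)
Let emb s : fps2 k := Fps2 (fun i j => if j == 0%N then coef s i else 0).

Let emb_inj : injective emb.
Proof.
move=> r s /(congr1 (fun f => fps_coef f)) ers; apply: fpsP => i.
by have /(congr1 (fun f => f i 0%N)) := ers.
Qed.

Let embM r s : emb (mul r s) = emb r * emb s.
Proof.
apply: fps2P => i j; rewrite fps_coefM /=; case: j => [|j] /=.
  by apply: eq_bigr => a _; rewrite big_ord1.
rewrite big1 // => a _; rewrite big1 // => b _ /=.
by case: (nat_of_ord b) => [|b']; rewrite ?subn0 /= ?mulr0 ?mul0r.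
Qed.

Fact fps1_mulC : commutative mul.
Proof. by move=> f g; apply: emb_inj; rewrite !embM mulrC. Qed.
Fact fps1_mulA : associative mul.
Proof. by move=> f g h; apply: emb_inj; rewrite !embM mulrA. Qed.
Fact fps1_mul1 : left_id one mul.
Proof.
move=> f; apply: fpsP => i /=; rewrite big_ord_recl /= mul1r subn0.
by rewrite big1 ?addr0 // => a _; rewrite mul0r.
Qed.
Fact fps1_mulDl : left_distributive mul add.
Proof.
move=> f g h; apply: fpsP => i /=; rewrite -big_split /=.
by apply: eq_bigr => a _; rewrite mulrDl.
Qed.
Fact fps1_oner_neq0 : one != zero.
Proof.
by apply/eqP => /(congr1 (fun f => coef f 0)) /= /eqP; rewrite oner_eq0.
Qed.
HB.instance Definition _ := GRing.Zmodule_isComNzRing.Build (fps k)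
  fps1_mulA fps1_mulC fps1_mul1 fps1_mulDl fps1_oner_neq0.

Lemma fcoefD r s n : coef (r + s) n = coef r n + coef s n. Proof. by []. Qed.
Lemma fcoefN s n : coef (- s) n = - coef s n. Proof. by []. Qed.
Lemma fcoefB r s n : coef (r - s) n = coef r n - coef s n. Proof. by []. Qed.
Lemma fcoef0 n : coef (0 : fps k) n = 0. Proof. by []. Qed.
Lemma fcoef1 n : coef (1 : fps k) n = (n == 0%N)%:R. Proof. by []. Qed.
Lemma fcoefM r s n : coef (r * s) n = \sum_(i < n.+1) coef r i * coef s (n - i).
Proof. by []. Qed.
Lemma fcoefM0 r s : coef (r * s) 0 = coef r 0 * coef s 0.
Proof. by rewrite fcoefM big_ord1. Qed.
Definition fps_t : fps k := Fps (fun n => (n == 1%N)%:R).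
Definition cst (a : k) : fps k := Fps (fun n => if n == 0%N then a else 0).

Lemma coef_cstM a s n : coef (cst a * s) n = a * coef s n.
Proof.
rewrite fcoefM big_ord_recl /= subn0 big1 ?addr0 // => i _.
by rewrite mul0r.
Qed.

Lemma coef_tM s n : coef (fps_t * s) n = if n is m.+1 then coef s m else 0.
Proof.
rewrite fcoefM; case: n => [|n]; first by rewrite big_ord1 mul0r.
rewrite !big_ord_recl big1 => [|i _]; rewrite /= ?mul0r //.
by rewrite add0r mul1r addr0 subSS subn0.
Qed.

Lemma coef_tXM s m n :
  coef (fps_t ^+ m * s) n = if (n < m)%N then 0 else coef s (n - m).
Proof.
elim: m n => [|m IHm] n; first by rewrite expr0 mul1r ltn0 subn0.
by rewrite exprS -mulrA coef_tM; case: n => [|n] //; rewrite IHm.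
Qed.

Lemma coef_tX m n : coef (fps_t ^+ m) n = (n == m)%:R.
Proof.
rewrite -[fps_t ^+ m]mulr1 coef_tXM fcoef1; case: ltngtP => // [mn|->].
  by rewrite subn_eq0 leqNgt mn.
by rewrite subnn.
Qed.

Lemma t_dvd s m : (forall i, (i < m)%N -> coef s i = 0) ->
  s = fps_t ^+ m * Fps (fun i => coef s (m + i)).
Proof.
move=> s0; apply: fpsP => n; rewrite coef_tXM /=.
by case: ltnP => [/s0|mn]; rewrite // subnKC.
Qed.

Lemma fps_expand2 s : s = cst (coef s 0) + cst (coef s 1) * fps_t +
  fps_t ^+ 2 * Fps (fun i => coef s (2 + i)).
Proof.
apply: fpsP => n; rewrite !fcoefD coef_cstM coef_tXM.
by case: n => [|[|n]] /=; rewrite ?subn2 ?mulr0 ?mulr1 ?addr0 ?add0r.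
Qed.

Lemma tXM_inj m : injective (fun s => fps_t ^+ m * s).
Proof.
move=> r s ers; apply: fpsP => i.
have E : coef (fps_t ^+ m * r) (m + i) = coef (fps_t ^+ m * s) (m + i) by congr coef.
by move: E; rewrite !coef_tXM -ltn_subRL subnn ltn0 addKn.
Qed.

Lemma fps_unit s : coef s 0 != 0 -> exists r, r * s = 1.
Proof.
move=> s0.
(* The coefficient of the inverse that follows the initial coefficients [l], solved from the
   convolution; [nilp l] is the constant coefficient of 1. *)
pose next (l : seq k) : k := (coef s 0)^-1 *
  ((nilp l)%:R - \sum_(i < size l) l`_i * coef s (size l - i)).
pose l := fix l n := if n is m.+1 then rcons (l m) (next (l m)) else [::].
have size_l n : size (l n) = n by elim: n => //= n IHn; rewrite size_rcons IHn.
have nth_l n i : (i < n)%N -> (l n)`_i = (l i.+1)`_i.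
  elim: n => // n IHn; rewrite ltnS leq_eqVlt => /orP[/eqP->//|ltin].
  by rewrite -IHn //= nth_rcons size_l ltin.
exists (Fps (fun n => (l n.+1)`_n)); apply: fpsP => n.
rewrite fcoefM big_ord_recr /= subnn nth_rcons size_l ltnn eqxx mulrC /next.
rewrite mulrA mulfV // mul1r size_l /nilp size_l.
rewrite (eq_bigr (fun i : 'I_n => (l n)`_i * coef s (n - i))) => [|i _].
  by rewrite addrC subrK.
by rewrite [in RHS]nth_l.
Qed.

Lemma fps_factor s : s <> 0 -> exists m u v, s = fps_t ^+ m * u /\ v * u = 1.
Proof.
move=> s0; have [n sn] : exists n, coef s n != 0.
  apply: contrapT => nz; apply: s0; apply: fpsP => i; apply/eqP/negPn/negP => si.
  by apply: nz; exists i.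
have [m sm mmin] := @ex_minnP (fun n => coef s n != 0) (ex_intro _ n sn).
have sdef : s = fps_t ^+ m * Fps (fun i => coef s (m + i)).
  by apply: t_dvd => i im; apply: contraTeq im => /mmin; rewrite -leqNgt.
have [|v vu] := @fps_unit (Fps (fun i => coef s (m + i))); first by rewrite /= addn0.
by exists m, (Fps (fun i => coef s (m + i))), v.
Qed.

Lemma fps_mulf r s : r * s = 0 -> r <> 0 -> s = 0.
Proof.
move=> rs0 /fps_factor[m [u [v [rdef vu]]]]; apply: (@tXM_inj m).
by rewrite mulr0 -[s]mul1r -vu [v * u * s](_ : _ = u * s * v) ?mulrA -?rdef ?rs0 ?mul0r //; ring.
Qed.

Lemma fps_mulI r s s' : r <> 0 -> r * s = r * s' -> s = s'.
Proof.
move=> r0 ers; apply/eqP; rewrite -subr_eq0; apply/eqP; apply: fps_mulf r0.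
by rewrite mulrBr ers subrr.
Qed.

Lemma tX_neq0 m : fps_t ^+ m <> 0.
Proof.
move=> /(congr1 (fun f => coef f m)); rewrite coef_tX eqxx fcoef0.
by move/eqP; rewrite oner_eq0.
Qed.

(** S is a discrete valuation ring: a member of least order divides all the others, since what
    remains of it after removing a power of t is a unit. *)
Lemma fps_min_dvd (A : set (fps k)) a0 : A a0 ->
  exists2 a, A a & forall b, A b -> exists c, b = c * a.
Proof.
move=> Aa0.
have [[a1 Aa1 a1N0]|A0] := pselect (exists2 a, A a & a <> 0); last first.
  exists a0 => // b Ab; exists 0; rewrite mul0r; apply: contrapT => b0.
  by apply: A0; exists b.
have [n a1n] : exists n, coef a1 n != 0.
  apply: contrapT => nz; apply: a1N0; apply: fpsP => i; apply/eqP/negPn/negP => si.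
  by apply: nz; exists i.
pose P n := `[< exists2 a, A a & coef a n != 0 >].
have exP : exists n, P n by exists n; apply/asboolP; exists a1.
have [m /asboolP[a Aa am] mmin] := ex_minnP exP.
have low b i : A b -> (i < m)%N -> coef b i = 0.
  move=> Ab; apply: contraTeq => bi; rewrite -leqNgt; apply: mmin.
  by apply/asboolP; exists b.
have [|v vu] := @fps_unit (Fps (fun i => coef a (m + i))); first by rewrite /= addn0.
exists a => // b Ab; have adef := t_dvd (fun i => low a i Aa).
exists (Fps (fun i => coef b (m + i)) * v); rewrite [in RHS]adef.
rewrite [LHS](t_dvd (fun i => low b i Ab)) mulrCA -!mulrA [v * _]mulrC.
by rewrite [_ * v]mulrC vu mulr1 // mulrC.
Qed.

End PowerSeries.

Arguments fps_t {k}.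
Arguments cst {k}.

Section Parametrization.
Variable k : fieldType.
Implicit Types f g : fps2 k.

(* x |-> - t^2, y |-> t^3 *)
Definition param f : fps k := Fps (fun n =>
  \sum_(i < n.+1) \sum_(j < n.+1)
    if (2 * i + 3 * j == n)%N then (-1) ^+ i * fps_coef f i j else 0).

(** The same substitution on polynomials, where it is visibly multiplicative; each coefficient of
    [param] is computed from a truncation, so multiplicativity carries over. *)
Let ev (q : {poly {poly k}}) : {poly k} :=
  (map_poly (comp_poly 'X^3) q).[- 'X^2].

Let evM p q : ev (p * q) = ev p * ev q.
Proof. by rewrite /ev rmorphM /= hornerM. Qed.

Let big_widen (F : nat -> k) m n : (m <= n)%N ->
  (forall i, (m <= i)%N -> F i = 0) -> \sum_(i < m) F i = \sum_(i < n) F i.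
Proof.
move=> lemn F0; rewrite -(subnKC lemn) big_split_ord /= [X in _ + X]big1 ?addr0 // => i _.
by rewrite F0 // leq_addr.
Qed.

Let coef_ev q n N : (n < N)%N -> (ev q)`_n =
  \sum_(i < N) \sum_(j < N)
    if (2 * i + 3 * j == n)%N then (-1) ^+ i * q`_i`_j else 0.
Proof.
move=> ltnN.
pose F (p : {poly k}) i j :=
  if (2 * i + 3 * j == n)%N then (-1) ^+ i * p`_j else 0.
have E (p : {poly k}) i : ((p \Po 'X^3) * (- 'X^2) ^+ i)`_n = \sum_(j < N) F p i j.
  transitivity (\sum_(j < size p) F p i j).
    rewrite comp_polyE mulr_suml coef_sum; apply: eq_bigr => j _.
    rewrite -!exprM exprNn -exprM.
    have -> : (-1) ^+ i = ((-1) ^+ i)%:P :> {poly k} by rewrite rmorphXn rmorphN1.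
    rewrite mul_polyC -scalerAr -scalerAl !coefZ -exprD coefXn /F addnC eq_sym.
    by case: eqP; rewrite ?mulr1 ?mulr0.
  rewrite (@big_widen (F p i) _ (maxn N (size p))) ?leq_maxr //.
    rewrite -(@big_widen (F p i) N) ?leq_maxl // /F => j Nj.
    by case: eqP => // ?; lia.
  by rewrite /F => j pj; rewrite nth_default // mulr0 if_same.
pose G i := \sum_(j < N) F q`_i i j.
have -> : (ev q)`_n = \sum_(i < size q) G i.
  rewrite /ev (@horner_coef_wide _ (size q)) ?size_poly // coef_sum.
  by apply: eq_bigr => i _; rewrite coef_map /= E.
rewrite (@big_widen G _ (maxn N (size q))) ?leq_maxr //.
  rewrite -(@big_widen G N) ?leq_maxl // /G /F => i Ni.
  by rewrite big1 // => j _; case: eqP => // ?; lia.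
rewrite /G /F => i qi; rewrite big1 // => j _.
by rewrite (nth_default 0 qi) coef0 mulr0 if_same.
Qed.

Let tr n f : {poly {poly k}} := \poly_(i < n) \poly_(j < n) fps_coef f i j.

Let trE n f i j : (i < n)%N -> (j < n)%N -> (tr n f)`_i`_j = fps_coef f i j.
Proof. by move=> ltin ltjn; rewrite !(coef_poly, ltin, ltjn). Qed.

Let param_ev f n N : (n < N)%N -> coef (param f) n = (ev (tr N f))`_n.
Proof.
move=> ltnN; rewrite (@coef_ev _ n n.+1) //; apply: eq_bigr => i _.
apply: eq_bigr => j _; rewrite trE //; exact: leq_trans (ltn_ord _) _.
Qed.

Fact param_zmod_morphism : zmod_morphism param.
Proof.
move=> f g; apply: fpsP => n; rewrite fcoefB /= -sumrB; apply: eq_bigr => i _.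
rewrite -sumrB; apply: eq_bigr => j _.
by case: ifP => _; rewrite ?subr0 // mulrBr.
Qed.
HB.instance Definition _ := GRing.isZmodMorphism.Build _ _ param param_zmod_morphism.

Fact param_monoid_morphism : monoid_morphism param.
Proof.
split.
  apply: fpsP => n; rewrite /= pair_big /=.
  case: n => [|n].
    rewrite (big_pred1 (ord0, ord0)) /= ?mulr1 // => -[i j].
    by rewrite !ord1; apply/esym/eqP.
  rewrite big1 // => -[[i ?] [j ?]] _ /=; case: eqP => // e.
  case: eqP => [i0|_]; last by rewrite mulr0.
  by case: eqP => [j0|_]; [lia | rewrite mulr0].
move=> f g; apply: fpsP => n.
rewrite (param_ev _ (ltnSn n)) fcoefM.
transitivity ((ev (tr n.+1 f * tr n.+1 g))`_n).
  rewrite !(@coef_ev _ n n.+1) //; apply: eq_bigr => i _; apply: eq_bigr => j _.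
  congr (if _ then _ * _ else _); rewrite trE // fps_coefM coefM coef_sum.
  apply: eq_bigr => a _; rewrite coefM; apply: eq_bigr => b _.
  have [[[? ?] ?] ?] := (ltn_ord i, ltn_ord j, ltn_ord a, ltn_ord b).
  rewrite !trE //; lia.
rewrite evM coefM; apply: eq_bigr => a _.
by rewrite -!param_ev // ltnS // leq_subr.
Qed.
HB.instance Definition _ :=
  GRing.isMonoidMorphism.Build _ _ param param_monoid_morphism.

Lemma coef_param_unique f n i j : (2 * i + 3 * j = n)%N ->
  (forall a b, (2 * a + 3 * b = n)%N -> (a, b) <> (i, j) -> fps_coef f a b = 0) ->
  coef (param f) n = (-1) ^+ i * fps_coef f i j.
Proof.
move=> eijn f0; rewrite /= pair_big /=.
have [lti ltj] : (i < n.+1 /\ j < n.+1)%N by lia.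
rewrite (bigD1 (Ordinal lti, Ordinal ltj)) //= eijn eqxx big1 ?addr0 // => -[a b] /= ab.
case: eqP => // eabn; rewrite f0 ?mulr0 // => -[ea eb].
by case/eqP: ab; congr pair; apply: val_inj.
Qed.

Lemma coef_param1 f : coef (param f) 1 = 0.
Proof.
rewrite /= big1 // => i _; rewrite big1 // => j _; case: eqP => // e; lia.
Qed.

Lemma param_X : param (fps_X k) = - fps_t ^+ 2.
Proof.
apply: fpsP => n; rewrite fcoefN coef_tX.
have [->|n2] := eqVneq n 2%N.
  rewrite (@coef_param_unique _ _ 1%N 0%N) //= ?expr1 ?mulr1 // => a b _.
  by case: eqP => //= ->; case: eqP => //= ->.
rewrite oppr0 /= big1 // => i _; rewrite big1 // => j _.
by case: eqP => // e; case: eqP => [i1|_]; case: eqP => [j0|_]; rewrite ?mulr0 //; lia.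
Qed.

Lemma param_Y : param (fps_Y k) = fps_t ^+ 3.
Proof.
apply: fpsP => n; rewrite coef_tX.
have [->|n2] := eqVneq n 3%N.
  rewrite (@coef_param_unique _ _ 0%N 1%N) //= ?expr0 ?mulr1 // => a b _.
  by case: eqP => //= ->; case: eqP => //= ->.
rewrite /= big1 // => i _; rewrite big1 // => j _.
by case: eqP => // e; case: eqP => [i1|_]; case: eqP => [j0|_]; rewrite ?mulr0 //; lia.
Qed.

Lemma param_cusp : param (cusp_poly k) = 0.
Proof.
have -> : param (cusp_poly k) = param (fps_X k) ^+ 3 + param (fps_Y k) ^+ 2.
  by rewrite rmorphD !rmorphXn.
by rewrite param_X param_Y; ring.
Qed.

(* Modulo x^3 + y^2 every series is congruent to some p(x) + q(x) y, whose
   image under the parametrization separates p and q by parity. *)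
Let ylinear (p q : nat -> k) : fps2 k :=
  Fps2 (fun i j => if j is 0%N then p i else if j is 1%N then q i else 0).

Let coef_ylinear_even p q i : coef (param (ylinear p q)) (2 * i) = (-1) ^+ i * p i.
Proof.
rewrite (@coef_param_unique _ _ i 0%N) ?muln0 ?addn0 // => a [|[|b]] //= e ne; last lia.
by case: ne; congr pair; lia.
Qed.

Let coef_ylinear_odd p q i :
  coef (param (ylinear p q)) (2 * i + 3) = (-1) ^+ i * q i.
Proof.
rewrite (@coef_param_unique _ _ i 1%N) ?muln1 // => a [|[|b]] //= e ne; first lia.
by case: ne; congr pair; lia.
Qed.

Let parity n : [\/ n = 1%N, exists i, n = (2 * i)%N | exists i, n = (2 * i + 3)%N].
Proof.
have := odd_double_half n; case: (odd n) => /= e.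
  by case: (n./2) e => [|m] e; [constructor 1 | constructor 3; exists m]; lia.
by constructor 2; exists n./2; lia.
Qed.

Lemma param_surj s : coef s 1 = 0 -> exists f, param f = s.
Proof.
move=> s1; exists (ylinear (fun i => (-1) ^+ i * coef s (2 * i))
                           (fun i => (-1) ^+ i * coef s (2 * i + 3))).
apply: fpsP => n; have [->|[i ->]|[i ->]] := parity n; first by rewrite coef_param1.
  by rewrite coef_ylinear_even mulrA -expr2 sqrr_sign mul1r.
by rewrite coef_ylinear_odd mulrA -expr2 sqrr_sign mul1r.
Qed.

Let coefMX f i j :
  fps_coef (f * fps_X k) i j = if i is i'.+1 then fps_coef f i' j else 0.
Proof.
rewrite mulrC fps_coefM; case: i => [|i].
  by rewrite big1 // => a _; rewrite big1 // => b _; rewrite ord1 mul0r.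
rewrite 2!big_ord_recl /= big1 => [|b _]; last by rewrite mul0r.
rewrite big_ord_recl /= big1 => [|b _]; last by rewrite mul0r.
rewrite big1 => [|a _]; last by rewrite big1 // => b _; rewrite mul0r.
by rewrite add0r !addr0 mul1r subSS !subn0.
Qed.

Let coefMY f i j :
  fps_coef (f * fps_Y k) i j = if j is j'.+1 then fps_coef f i j' else 0.
Proof.
rewrite mulrC fps_coefM big_ord_recl [X in _ + X]big1 => [|a _]; last first.
  by rewrite big1 // => b _; rewrite mul0r.
rewrite addr0 subn0; case: j => [|j]; first by rewrite big_ord1 mul0r.
rewrite 2!big_ord_recl /= big1 => [|b _]; last by rewrite mul0r.
by rewrite mul0r add0r addr0 mul1r subSS !subn0.
Qed.

Lemma param_eq0 f : param f = 0 <-> f \in @cusp_ideal k.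
Proof.
split=> [f0|/asboolP[g ->]]; last by rewrite rmorphM /= param_cusp mulr0.
(* Division by x^3 + y^2, monic in y: the coefficient of x^i y^(j+2) demands g i j + g (i-3) (j+2) =
   f i (j+2), a recursion on i. The remainder has degree at most 1 in y. *)
pose g := fix g (i j : nat) {struct i} : k :=
  fps_coef f i j.+2 - if i is i'.+3 then g i' j.+2 else 0.
have gE i j : g i j = fps_coef f i j.+2 - if i is i'.+3 then g i' j.+2 else 0.
  by case: i.
pose G := Fps2 g; apply/asboolP; exists G; apply/eqP; rewrite -subr_eq0; apply/eqP.
set r := f - _.
have r2 i j : fps_coef r i j.+2 = 0.
  rewrite /r /cusp_poly mulrDr !exprS expr0 !mulr1 !mulrA.
  have NE (u : fps2 k) a b : fps_coef (- u) a b = - fps_coef u a b by [].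
  rewrite fps_coefD NE fps_coefD !coefMY.
  rewrite [fps_coef G _ _]gE opprD opprB addrCA [X in _ + X]addrC subrK addrC.
  by case: i => [|[|[|i]]]; rewrite !coefMX ?subrr // subrr.
have rl : r = ylinear (fun i => fps_coef r i 0) (fun i => fps_coef r i 1).
  by apply: fps2P => i [|[|j]]; [| |exact: r2].
have r0 : param r = 0 by rewrite rmorphB /= f0 rmorphM /= param_cusp mulr0 subrr.
have cancel_sign i (x : k) : (-1) ^+ i * x = 0 -> x = 0.
  by move/(congr1 ( *%R ((-1) ^+ i))); rewrite mulrA -expr2 sqrr_sign mul1r mulr0.
apply: fps2P => i [|[|j]]; last exact: r2.
  have := coef_ylinear_even (fun i => fps_coef r i 0) (fun i => fps_coef r i 1) i.
  by rewrite -rl r0 => /esym/cancel_sign.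
have := coef_ylinear_odd (fun i => fps_coef r i 0) (fun i => fps_coef r i 1) i.
by rewrite -rl r0 => /esym/cancel_sign.
Qed.

End Parametrization.

Section CuspRing.
Variable k : fieldType.
Notation R := (cusp_ring k).
Let Q := {ideal_quot (@cusp_ideal k)}.

Definition phi0 (r : R) : fps k := param (repr r).

Lemma phi0_pi (f : fps2 k) : phi0 (\pi_R f) = param f.
Proof.
apply/eqP; rewrite -subr_eq0 -rmorphB; apply/eqP/param_eq0.
by rewrite Quotient.idealrBE reprK.
Qed.

Fact phi0_zmod_morphism : zmod_morphism phi0.
Proof.
by move=> r s; rewrite -[r]reprK -[s]reprK -[_ - _]raddfB !phi0_pi rmorphB.
Qed.
HB.instance Definition _ := GRing.isZmodMorphism.Build _ _ phi0 phi0_zmod_morphism.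

Fact phi0_monoid_morphism : monoid_morphism phi0.
Proof.
split=> [|r s].
  by have <- : \pi_Q (1 : fps2 k) = 1 :> Q; [exact: rmorph1 | rewrite phi0_pi rmorph1].
rewrite -[r]reprK -[s]reprK.
have <- : \pi_Q (repr r * repr s) = \pi_Q (repr r) * \pi_Q (repr s) :> Q.
  exact: rmorphM.
by rewrite !phi0_pi rmorphM.
Qed.
HB.instance Definition _ :=
  GRing.isMonoidMorphism.Build _ _ phi0 phi0_monoid_morphism.

Lemma phi0_inj : injective phi0.
Proof.
move=> r s ers; rewrite -[r]reprK -[s]reprK; apply/eqP.
rewrite -Quotient.idealrBE; apply/param_eq0; apply/eqP.
by rewrite rmorphB subr_eq0; exact/eqP.
Qed.

Lemma parametrization_ex : exists phi : {rmorphism R -> fps k},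
  [/\ injective phi, forall r, coef (phi r) 1 = 0
    & forall s, coef s 1 = 0 -> exists r, phi r = s].
Proof.
exists phi0; split=> [|r|s]; [exact: phi0_inj | exact: coef_param1 |].
by move=> /param_surj[f <-]; exists (\pi_R f); exact: phi0_pi.
Qed.

(** Extracted from an opaque existence proof, so that only its three properties are available and
    the quotient construction never unfolds. *)
Definition phi : {rmorphism R -> fps k} := sval (cid parametrization_ex).

Let phiP := svalP (cid parametrization_ex).

Lemma phi_inj : injective phi. Proof. by case: phiP. Qed.

Lemma coef_phi1 r : coef (phi r) 1 = 0. Proof. by case: phiP. Qed.

Lemma phi_surj s : coef s 1 = 0 -> exists r, phi r = s.
Proof. by case: phiP => _ _; apply. Qed.

End CuspRing.

(** * Torsion-free modules over the cusp *)

Section CuspArithmetic.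
Variable k : fieldType.
Notation R := (cusp_ring k).
Notation phi := (@phi k).
Notation t := (@fps_t k).

Let sect_ex : exists f : fps k -> R, forall s, coef s 1 = 0 -> phi (f s) = s.
Proof.
have /choice[f fP] s : exists r : R, coef s 1 = 0 -> phi r = s.
  by have [/phi_surj[r <-]|s1] := pselect (coef s 1 = 0); [exists r | exists 0].
by exists f.
Qed.
(** The inverse of [phi] on its image, with arbitrary values on series that have a linear term. *)
Definition sect : fps k -> R := sval (cid sect_ex).
Lemma sectK s : coef s 1 = 0 -> phi (sect s) = s.
Proof. exact: (svalP (cid sect_ex)). Qed.

(* The conductor of R in S = k[[t]] is the maximal ideal t^2 S of R, and rho is
   the multiplication by t^2 from S to R. *)
Definition rho (s : fps k) : R := sect (t ^+ 2 * s).
Definition kap (a : k) : R := sect (cst a).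
Definition X : R := rho 1.
Definition Y : R := rho t.

Lemma phi_rho s : phi (rho s) = t ^+ 2 * s.
Proof. by apply: sectK; rewrite coef_tXM. Qed.

Lemma phi_kap a : phi (kap a) = cst a.
Proof. exact: sectK. Qed.

Lemma phi_X : phi X = t ^+ 2. Proof. by rewrite phi_rho mulr1. Qed.
Lemma phi_Y : phi Y = t ^+ 3. Proof. by rewrite phi_rho exprS mulrC. Qed.

Lemma rhoD r s : rho (r + s) = rho r + rho s.
Proof. by apply: phi_inj; rewrite rmorphD /= !phi_rho mulrDr. Qed.
Lemma rhoN s : rho (- s) = - rho s.
Proof. by apply: phi_inj; rewrite rmorphN /= !phi_rho mulrN. Qed.
Lemma rhoB r s : rho (r - s) = rho r - rho s.
Proof. by rewrite rhoD rhoN. Qed.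
Lemma rho0 : rho 0 = 0.
Proof. by apply: phi_inj; rewrite rmorph0 phi_rho mulr0. Qed.
Lemma rho_phiM r s : rho (phi r * s) = r * rho s.
Proof. by apply: phi_inj; rewrite rmorphM /= !phi_rho; ring. Qed.
Lemma rho_phi r : rho (phi r) = r * X.
Proof. by rewrite -rho_phiM mulr1. Qed.
Lemma rhoM r s : rho r * rho s = X * rho (r * s).
Proof. by apply: phi_inj; rewrite !rmorphM /= !phi_rho; ring. Qed.
Lemma rho_inj : injective rho.
Proof.
by move=> r s ers; apply: (@tXM_inj _ 2); rewrite -!phi_rho ers.
Qed.
Lemma Y_rho s : Y * rho s = X * rho (t * s). Proof. exact: rhoM. Qed.
Lemma rho_cst a s : rho (cst a * s) = kap a * rho s.
Proof. by rewrite -rho_phiM phi_kap. Qed.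

Lemma kapD a b : kap (a + b) = kap a + kap b.
Proof.
apply: phi_inj; rewrite rmorphD /= !phi_kap; apply: fpsP => -[|n] //.
by rewrite fcoefD /= addr0.
Qed.

Lemma kap1 : kap 1 = 1.
Proof. by apply: phi_inj; rewrite phi_kap rmorph1; apply: fpsP => -[|n]. Qed.

Lemma kapM a b : kap (a * b) = kap a * kap b.
Proof.
apply: phi_inj; rewrite rmorphM !phi_kap; apply: fpsP => n.
by rewrite coef_cstM; case: n => //= n; rewrite mulr0.
Qed.

Lemma rho_surj r : coef (phi r) 0 = 0 -> exists s, r = rho s.
Proof.
move=> r0; exists (Fps (fun i => coef (phi r) (2 + i))).
apply: phi_inj; rewrite phi_rho; apply: t_dvd => -[|[|i]] // _.
exact: coef_phi1.
Qed.

Lemma cusp_decomp r : exists s, r = kap (coef (phi r) 0) + rho s.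
Proof.
have [|s es] := @rho_surj (r - kap (coef (phi r) 0)).
  by rewrite rmorphB phi_kap fcoefB subrr.
by exists s; rewrite -es addrC subrK.
Qed.

Lemma rho0_coef s : coef (phi (rho s)) 0 = 0.
Proof. by rewrite phi_rho coef_tXM. Qed.

Lemma cusp_unit r : coef (phi r) 0 != 0 -> exists r', r' * r = 1.
Proof.
move=> r0; have [v vr] := fps_unit r0.
have /phi_surj[r' er'] : coef v 1 = 0.
  have := congr1 (fun s => coef s 1) vr.
  rewrite fcoefM !big_ord_recl big_ord0 /= subn0 coef_phi1 mulr0 add0r addr0.
  by move/eqP; rewrite mulf_eq0 (negPf r0) orbF => /eqP.
by exists r'; apply: phi_inj; rewrite rmorphM /= er' vr rmorph1.
Qed.

Lemma nonunitP r : nonunits r <-> exists s, r = rho s.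
Proof.
split=> [nr|[s ->] [b /(congr1 (fun r => coef (phi r) 0))]].
  by apply: rho_surj; apply/eqP/negPn/negP => /cusp_unit.
rewrite rmorphM rmorph1 fcoefM0 rho0_coef mulr0 => /eqP.
by rewrite eq_sym oner_eq0.
Qed.

Lemma cusp_mulf (r s : R) : r * s = 0 -> r <> 0 -> s = 0.
Proof.
move=> rs0 r0; apply: phi_inj; rewrite rmorph0; apply: (@fps_mulf _ (phi r)).
  by rewrite -rmorphM rs0 rmorph0.
by move=> pr0; apply: r0; apply: phi_inj; rewrite pr0 rmorph0.
Qed.

(** If [phi r] is t^m u with u a unit, the factor t^2 t^m u^-1 completes it to the even power
    t^(2m+2). Thus a module on which X is injective is torsion-free. *)
Lemma dvd_Xn r : r <> 0 -> exists s m, rho s * r = X ^+ m.+1.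
Proof.
move=> r0; have [|m [u [v [er vu]]]] := @fps_factor _ (phi r).
  by move=> pr0; apply: r0; apply: phi_inj; rewrite pr0 rmorph0.
exists (t ^+ m * v), m; apply: phi_inj.
rewrite rmorphM rmorphXn /= phi_rho phi_X er.
transitivity (t ^+ (2 * m.+1) * (v * u)).
  by rewrite mulnS exprD mul2n -addnn exprD; ring.
by rewrite vu mulr1 exprM.
Qed.

(** The square of [rho s] is a multiple of X, and [a] divides a power of X. This is what bounds both
    the Krull dimension and the depth by 1. *)
Lemma nonunit_pow_dvd a s : a <> 0 -> exists n c, rho s ^+ n = c * a.
Proof.
move=> /dvd_Xn[s' [m e]]; exists (2 * m.+1)%N, (rho (s ^+ 2) ^+ m.+1 * rho s').
by rewrite -mulrA e exprM expr2 rhoM -expr2 -exprMn mulrC.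
Qed.

Lemma X_neq0 : X <> 0.
Proof.
by move=> /(congr1 phi); rewrite phi_X rmorph0 => /tX_neq0.
Qed.

(** The equation says that t r belongs to R, and the linear coefficient of t r is the constant
    coefficient of r. It forces R-coordinates into m throughout. *)
Lemma XY_conductor r r' : Y * r = X * r' -> exists s, r = rho s.
Proof.
move=> /(congr1 phi); rewrite !rmorphM /= phi_X phi_Y => e; apply: rho_surj.
have {}e : t * phi r = phi r' by apply: (@tXM_inj _ 2); rewrite -e /=; ring.
have := congr1 (fun s => coef s 1) e; rewrite coef_tM => ->; exact: coef_phi1.
Qed.

(** The right-hand side has order at least 4 in t. *)
Lemma X_notin_square s s' : X <> X * rho s + Y * rho s'.
Proof.
move=> /(congr1 (fun r => coef (phi r) 2)).
rewrite rmorphD !rmorphM phi_X phi_Y !phi_rho fcoefD.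
rewrite !coef_tXM coef_tX addr0 => /eqP.
by rewrite oner_eq0.
Qed.

End CuspArithmetic.

Arguments X {k}.
Arguments Y {k}.

Definition normalization (k : fieldType) : Type := fps k.
HB.instance Definition _ k := GRing.Zmodule.on (normalization k).

Section Normalization.
Variable k : fieldType.
Let scale (r : cusp_ring k) (s : normalization k) : normalization k :=
  phi k r * (s : fps k).
Fact normalization_scaleA a b u : scale a (scale b u) = scale (a * b) u.
Proof. by rewrite /scale mulrA -rmorphM. Qed.
Fact normalization_scale1 : left_id 1 scale.
Proof. by move=> u; rewrite /scale rmorph1 mul1r. Qed.
Fact normalization_scaleDr : right_distributive scale +%R.
Proof. by move=> a u v; rewrite /scale mulrDr. Qed.
Fact normalization_scaleDl u : {morph scale^~ u : a b / a + b}.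
Proof. by move=> a b; rewrite /scale rmorphD mulrDl. Qed.
HB.instance Definition _ := GRing.Zmodule_isLmodule.Build (cusp_ring k)
  (normalization k) normalization_scaleA normalization_scale1
  normalization_scaleDr normalization_scaleDl.

Lemma normalization_scaleE (r : cusp_ring k) (s : normalization k) :
  r *: s = phi k r * (s : fps k) :> fps k.
Proof. by []. Qed.

Lemma normalization_torsion_free (s : normalization k) : X *: s = 0 -> s = 0.
Proof.
rewrite normalization_scaleE phi_X => e; apply: (@tXM_inj _ 2).
by rewrite e mulr0.
Qed.
End Normalization.

Section TorsionFree.
Variables (k : fieldType) (M : lmodType (cusp_ring k)).
Notation R := (cusp_ring k).
Notation S := (normalization k).
Notation phi := (@phi k).
Notation t := (@fps_t k).
Hypothesis Xinj : forall v : M, X *: v = 0 -> v = 0.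

Lemma X_inj (v w : M) : X *: v = X *: w -> v = w.
Proof.
by move=> e; apply/eqP; rewrite -subr_eq0; apply/eqP/Xinj; rewrite scalerBr e subrr.
Qed.

Lemma torsion_free (r : R) (v : M) : r <> 0 -> r *: v = 0 -> v = 0.
Proof.
move=> /dvd_Xn[s [m e]] rv0.
have : X ^+ m.+1 *: v = 0 by rewrite -e -scalerA rv0 scaler0.
elim: m.+1 => [|n IHn]; first by rewrite scale1r.
by rewrite exprS -scalerA => /Xinj.
Qed.

(* As X and Y act as t^2 and t^3, this says that t v belongs to M. *)
Definition stable (v : M) := exists w, X *: w = Y *: v.

Lemma smul_ex : exists f : fps k -> M -> M, forall s v, stable v ->
  X *: f s v = rho s *: v.
Proof.
have /choice[f fP] : forall sv : fps k * M, exists w, stable sv.2 ->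
    X *: w = rho sv.1 *: sv.2.
  move=> [s v] /=; have [[w ew]|?] := pselect (stable v); last by exists 0.
  (* Write s = c0 + c1 t + t^2 s2. With w in the role of t v, the product s v is c0 v + c1 w + (t^2
     s2) v, whose coefficients all lie in R. *)
  pose s2 := Fps (fun i => coef s (2 + i)).
  exists (kap (coef s 0) *: v + kap (coef s 1) *: w + rho s2 *: v) => _.
  rewrite !scalerDr !scalerA [X * kap (coef s 1)]mulrC.
  rewrite -[(_ * X) *: w]scalerA ew scalerA -!scalerDl.
  congr (_ *: _); apply: phi_inj.
  rewrite !rmorphD !rmorphM /= !phi_kap phi_X phi_Y !phi_rho.
  have -> : t ^+ 2 * s = t ^+ 2 * (cst (coef s 0) + cst (coef s 1) * t + t ^+ 2 * s2).
    by congr (_ * _); exact: fps_expand2.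
  by ring.
by exists (fun s v => f (s, v)) => s v; exact: (fP (s, v)).
Qed.

(** The action of S on the stable elements, with arbitrary values elsewhere; injectivity of X makes
    [smulP] determine it. *)
Definition smul : fps k -> M -> M := sval (cid smul_ex).

Lemma smulP s v : stable v -> X *: smul s v = rho s *: v.
Proof. exact: (svalP (cid smul_ex)). Qed.

Lemma smulE s v w : stable v -> X *: w = rho s *: v -> smul s v = w.
Proof. by move=> sv ew; apply: X_inj; rewrite smulP. Qed.

Lemma stableP s v w : stable v -> X *: w = rho s *: v -> stable w.
Proof.
move=> sv ew; exists (smul (t * s) v); apply: X_inj.
by rewrite smulP // !scalerA [X * Y]mulrC -[(Y * X) *: w]scalerA ew scalerA Y_rho.
Qed.

Lemma stable_smul s v : stable v -> stable (smul s v).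
Proof. by move=> sv; apply: stableP (smulP s sv). Qed.

Lemma stable0 : stable 0. Proof. by exists 0; rewrite !scaler0. Qed.

Lemma stableD v w : stable v -> stable w -> stable (v + w).
Proof. by move=> [v' ev] [w' ew]; exists (v' + w'); rewrite !scalerDr ev ew. Qed.

Lemma smulDr s v w : stable v -> stable w -> smul s (v + w) = smul s v + smul s w.
Proof.
move=> sv sw; apply: smulE; first exact: stableD.
by rewrite !scalerDr !smulP.
Qed.

Lemma smulDl r s v : stable v -> smul (r + s) v = smul r v + smul s v.
Proof. by move=> sv; apply: smulE => //; rewrite scalerDr !smulP // rhoD scalerDl. Qed.

Lemma smul_phi r v : stable v -> smul (phi r) v = r *: v.
Proof. by move=> sv; apply: smulE => //; rewrite rho_phi scalerA mulrC. Qed.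

Lemma smul1 v : stable v -> smul 1 v = v.
Proof. by move=> sv; apply: smulE. Qed.

Lemma smul0 v : stable v -> smul 0 v = 0.
Proof. by move=> sv; apply: smulE; rewrite // rho0 scaler0 scale0r. Qed.

Lemma smulA r s v : stable v -> smul r (smul s v) = smul (r * s) v.
Proof.
move=> sv; apply: smulE; first exact: stable_smul.
apply: X_inj; rewrite smulP // !scalerA [X * rho r]mulrC -[(rho r * X) *: _]scalerA.
by rewrite smulP // scalerA rhoM.
Qed.

Lemma smul_phiM r s v : stable v -> smul (phi r * s) v = r *: smul s v.
Proof. by move=> sv; rewrite -smulA // smul_phi //; exact: stable_smul. Qed.

Lemma smul_linear v : stable v -> linear (smul^~ v : S -> M).
Proof. by move=> sv r s s'; rewrite smulDl // smul_phiM. Qed.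

Lemma stable_rho s v : stable (rho s *: v).
Proof.
by exists (rho (t * s) *: v); rewrite !scalerA Y_rho.
Qed.

Lemma smul_rho s s' v : smul s (rho s' *: v) = rho (s * s') *: v.
Proof.
apply: smulE; first exact: stable_rho.
by rewrite !scalerA rhoM.
Qed.

End TorsionFree.

(** * Decomposition of torsion-free modules into copies of R and S *)

Section Classification.
Variables (k : fieldType) (M : lmodType (cusp_ring k)).
Notation R := (cusp_ring k).
Notation S := (normalization k).
Notation phi := (@phi k).
Notation t := (@fps_t k).

(* A decomposition of M as a direct sum of copies of R (indices outside p,
   split by g and v1) and of S (indices in p, split by u2 and v2). *)
Definition decomposition (I : finType) (p : pred I) (g : I -> M)
    (v1 : I -> {linear M -> R^o}) (u2 : I -> {linear S -> M})
    (v2 : I -> {linear M -> S}) :=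
  [/\ forall m, m = \sum_(i | ~~ p i) (v1 i m : R) *: g i + \sum_(i | p i) u2 i (v2 i m),
      forall i, ~~ p i -> v1 i (g i) = 1
    & forall i s, p i -> v2 i (u2 i s) = s].

Hypothesis Xinj : forall v : M, X *: v = 0 -> v = 0.

(* The f i generate the S-module spanned by M; all coefficients are multiplied
   by t^2 to stay inside R. *)
Definition generating r (f : 'I_r -> M) :=
  forall v, exists s : 'I_r -> fps k, X *: v = \sum_i rho (s i) *: f i.

(** Dividing the relation by [s j], which torsion-freeness permits, leaves a relation with
    coefficient 1 at [j], and this one eliminates [f j]. *)
Lemma generating_drop r (f : 'I_r.+1 -> M) j s : generating f ->
  \sum_i rho (s i) *: f i = 0 -> s j <> 0 ->
  (forall i, exists c, s i = c * s j) -> generating (f \o lift j).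
Proof.
move=> fgen sf0 sj0 /choice[c cP] v; have [w ew] := fgen v.
have cj : c j = 1.
  by apply: (@fps_mulI _ (s j)) => //; rewrite mulrC -cP mulr1.
have wc0 : \sum_i rho (w j * c i) *: f i = 0.
  have rj0 : rho (s j) <> 0 by rewrite -(rho0 k) => /rho_inj.
  apply: (torsion_free Xinj rj0).
  transitivity (rho (w j) *: \sum_i rho (s i) *: f i); last by rewrite sf0 scaler0.
  rewrite !scaler_sumr; apply: eq_bigr => i _; rewrite !scalerA; congr (_ *: _).
  by rewrite rhoM [RHS]rhoM [in RHS]cP; congr (_ * rho _); ring.
exists (fun i => w (lift j i) - w j * c (lift j i)).
transitivity (\sum_i rho (w i - w j * c i) *: f i).
  rewrite -[LHS]subr0 -[X in _ - X]wc0 ew -sumrB; apply: eq_bigr => i _.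
  by rewrite rhoB scalerBl.
by rewrite (bigD1_ord j) //= cj mulr1 subrr rho0 scale0r add0r.
Qed.

(** In a nontrivial relation the coefficient of least order divides the others, so a member could be
    dropped. *)
Lemma generating_indep r (f : 'I_r -> M) s :
  (forall r' (f' : 'I_r' -> M), generating f' -> (r <= r')%N) -> generating f ->
  \sum_i rho (s i) *: f i = 0 -> forall i, s i = 0.
Proof.
case: r f s => [|r] f s rmin fgen sf0 i; first by case: i.
apply: contrapT => si.
have [|_ [j _ <-] jmin] := @fps_min_dvd _ [set s j | j in [set: 'I_r.+1]] (s i).
  by exists i.
have sj : s j <> 0.
  by move=> sj0; have [|c e] := jmin (s i); [exists i | apply: si; rewrite e sj0 mulr0].
have /rmin := generating_drop fgen sf0 sj (fun i => jmin _ (ex_intro2 _ _ i I erefl)).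
by rewrite ltnn.
Qed.

Lemma generating_replace r (f : 'I_r -> M) j (c : 'I_r -> k) : generating f ->
  c j != 0 ->
  generating (fun i => if i == j then \sum_i kap (c i) *: f i else f i).
Proof.
move=> fgen cj v; have [w ew] := fgen v.
(* The coefficient of the new member, chosen to restore [w j] on [f j]; what it adds on the other
   [f i] is subtracted from [w i]. *)
pose d := cst (c j)^-1 * w j.
exists (fun i => if i == j then d else w i - cst (c i) * d).
rewrite ew (bigD1 j) //= [RHS](bigD1 j) //= eqxx.
rewrite [\sum_i kap (c i) *: _](bigD1 j) //= scalerDr scaler_sumr -addrA -big_split.
congr (_ + _).
  rewrite scalerA mulrC -rho_cst; congr (rho _ *: _); rewrite /d mulrA.
  by apply: fpsP => n; rewrite -mulrA !coef_cstM mulrA mulfV // mul1r.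
apply: eq_bigr => i /negPf ij; rewrite ij /= rhoB scalerBl scalerA mulrC -rho_cst.
by rewrite addrC subrK.
Qed.

Lemma generating_minimal : fin_gen M -> exists r (f : 'I_r -> M),
  generating f /\ forall r' (f' : 'I_r' -> M), generating f' -> (r <= r')%N.
Proof.
move=> [n [g gP]].
pose P r := `[< exists f : 'I_r -> M, generating f >].
have exP : exists r, P r.
  exists n; apply/asboolP; exists g => v; have [a ->] := gP v.
  exists (fun i => phi (a i)); rewrite scaler_sumr; apply: eq_bigr => i _.
  by rewrite rho_phi scalerA mulrC.
have [r /asboolP[f fgen] rmin] := ex_minnP exP.
by exists r, f; split=> // r' f' f'gen; apply: rmin; apply/asboolP; exists f'.
Qed.

Lemma generating_extremal : fin_gen M -> exists r (f : 'I_r -> M),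
  [/\ generating f, forall s, \sum_i rho (s i) *: f i = 0 -> forall i, s i = 0
    & forall f' : 'I_r -> M, generating f' ->
        (#|[set i | `[< stable (f' i) >]]| <= #|[set i | `[< stable (f i) >]]|)%N].
Proof.
move=> /generating_minimal[r [f0 [f0gen rmin]]].
pose P n := `[< exists2 f : 'I_r -> M, generating f
                & #|[set i | `[< stable (f i) >]]| = n >].
have exP : exists n, P n.
  by exists #|[set i | `[< stable (f0 i) >]]|; apply/asboolP; exists f0.
have ubP n : P n -> (n <= r)%N.
  by move=> /asboolP[f _ <-]; rewrite -[X in (_ <= X)%N]card_ord max_card.
have [n /asboolP[f fgen fn] nmax] := ex_maxnP exP ubP.
exists r, f; split=> // [s sf|f' f'gen]; first exact: generating_indep sf.
by rewrite fn; apply: nmax; apply/asboolP; exists f'.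
Qed.

Lemma classification : fin_gen M ->
  exists (I : finType) (p : pred I) g v1 u2 v2, @decomposition I p g v1 u2 v2.
Proof.
move=> /generating_extremal[r [f [fgen findep fmax]]].
have [sc scP] := choice fgen.
have sc_uniq v s : X *: v = \sum_i rho (s i) *: f i -> forall i, sc v i = s i.
  move=> e i; apply/eqP; rewrite -subr_eq0; apply/eqP.
  move: i; apply: findep.
  under eq_bigr => i _ do rewrite rhoB scalerBl.
  by rewrite sumrB -scP -e subrr.
have sc_lin i : linear (fun v => sc v i : S).
  move=> a v w; apply: (sc_uniq _ (fun i => phi a * sc v i + sc w i)).
  rewrite scalerDr scalerA mulrC -scalerA !scP scaler_sumr -big_split.
  by apply: eq_bigr => j _; rewrite rhoD scalerDl rho_phiM scalerA.
pose p i := `[< stable (f i) >].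
(* Otherwise replacing f i by the t-linear part of v enlarges p. *)
have sc1 v i : ~~ p i -> coef (sc v i) 1 = 0.
  move=> npi; apply/eqP/negPn/negP => ci.
  pose f' i0 := if i0 == i then \sum_i kap (coef (sc v i) 1) *: f i else f i0.
  have /fmax : generating f' := generating_replace fgen ci.
  rewrite leqNgt => /negP; apply; apply: proper_card; apply/properP; split.
    apply/fintype.subsetP => j; rewrite !inE /f'; case: eqP => // -> pi.
    by case/negP: npi; apply/asboolP.
  exists i; rewrite inE // /f' eqxx; apply/asboolP.
  pose s2 i := Fps (fun n => coef (sc v i) (2 + n)).
  (* Removing from v its constant part and its part divisible by t^2 leaves t times the new member;
     since the removed parts lie in M, that member is stable. *)
  exists (v - \sum_i kap (coef (sc v i) 0) *: f i - \sum_i rho (s2 i) *: f i).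
  rewrite !scalerBr scP !scaler_sumr -!sumrB; apply: eq_bigr => j _.
  rewrite !scalerA -!scalerBl; congr (_ *: _); apply: phi_inj.
  rewrite !rmorphB !rmorphM phi_X phi_Y !phi_kap !phi_rho.
  have -> : t ^+ 2 * sc v j = t ^+ 2 * (cst (coef (sc v j) 0) +
      cst (coef (sc v j) 1) * t + t ^+ 2 * s2 j); last by ring.
  by congr (_ * _); exact: fps_expand2.
have /choice[v1 v1P] i : exists v1 : {linear M -> R^o},
    ~~ p i -> forall v, phi (v1 v) = sc v i.
  have [pi|npi] := boolP (p i).
    have zlin : linear (fun _ : M => 0 : R^o) by move=> a x y; rewrite scaler0 addr0.
    by exists (mklin zlin).
  have vlin : linear (fun v => sect (sc v i) : R^o).
    move=> a v w; apply: phi_inj.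
    by rewrite sectK ?sc1 // rmorphD rmorphM !sectK ?sc1 // sc_lin.
  by exists (mklin vlin) => _ v; rewrite sectK ?sc1.
have /choice[u2 u2P] i : exists u2 : {linear S -> M},
    p i -> forall s, X *: u2 s = rho s *: f i.
  have [pi|npi] := pselect (stable (f i)).
    by exists (mklin (smul_linear Xinj pi)) => _ s; exact: smulP.
  have zlin : linear (fun _ : S => 0 : M) by move=> a x y; rewrite scaler0 addr0.
  by exists (mklin zlin) => /asboolP.
have sc_single v i s : X *: v = rho s *: f i -> sc v i = s.
  move=> e; rewrite (sc_uniq v (fun j => if j == i then s else 0)) ?eqxx //.
  rewrite (bigD1 i) //= eqxx e big1 ?addr0 // => j /negPf->.
  by rewrite rho0 scale0r.
exists 'I_r, p, f, v1, u2, (fun i => mklin (sc_lin i)); split.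
- move=> v; apply: (X_inj Xinj); rewrite scalerDr scP (bigID p) /= addrC.
  rewrite !scaler_sumr; congr (_ + _); apply: eq_bigr => i pi.
    by rewrite -v1P // rho_phi scalerA mulrC.
  by rewrite u2P.
- move=> i npi; apply: phi_inj; rewrite v1P // rmorph1; apply: sc_single.
  by [].
- by move=> i s pi; apply: sc_single; exact: u2P.
Qed.

End Classification.

(** * Modules over the endomorphism ring *)

(** An alias that carries the scalar action of E and keeps it apart from the action of R on M. *)
Definition End_module (R : pzRingType) (M : lmodType R) : Type := M.

Section EndModule.
Variables (R : pzRingType) (M : lmodType R).
HB.instance Definition _ := GRing.Zmodule.on (End_module M).
Let scale (f : End_ring M) (v : End_module M) : End_module M := End_fun f v.
Fact End_module_scaleA a b u : scale a (scale b u) = scale (a * b) u.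
Proof. by []. Qed.
Fact End_module_scale1 : left_id 1 scale.
Proof. by []. Qed.
Fact End_module_scaleDr : right_distributive scale +%R.
Proof. by move=> a u v; rewrite /scale linearD. Qed.
Fact End_module_scaleDl u : {morph scale^~ u : a b / a + b}.
Proof. by []. Qed.
HB.instance Definition _ := GRing.Zmodule_isLmodule.Build (End_ring M)
  (End_module M) End_module_scaleA End_module_scale1
  End_module_scaleDr End_module_scaleDl.

Lemma End_module_scaleE (f : End_ring M) (v : End_module M) :
  f *: v = End_fun f v.
Proof. by []. Qed.

Definition endo (f : {linear M -> M}) : End_ring M := f.

Lemma endoE f v : End_fun (endo f) v = f v. Proof. by []. Qed.

Lemma End_mulE (f g : End_ring M) v : End_fun (f * g) v = End_fun f (End_fun g v).
Proof. by []. Qed.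

Lemma End_addE (f g : End_ring M) v : End_fun (f + g) v = End_fun f v + End_fun g v.
Proof. by []. Qed.
End EndModule.

Section StableSubmodule.
Variables (k : fieldType) (M : lmodType (cusp_ring k)).
Notation R := (cusp_ring k).
Notation S := (normalization k).
Notation phi := (@phi k).
Notation t := (@fps_t k).
Notation E := (End_ring M).
Notation EM := (End_module M).
Hypothesis Xinj : forall v : M, X *: v = 0 -> v = 0.

Lemma stable_linear (N : lmodType R) (f : {linear N -> M}) v :
  stable v -> stable (f v).
Proof. by move=> [w ew]; exists (f w); rewrite -!linearZ ew. Qed.

Lemma stable_normalization (s : S) : stable s.
Proof.
exists (t * s : fps k); rewrite !normalization_scaleE phi_X phi_Y.
by rewrite mulrA -exprSr.
Qed.

Lemma smul_linear_map (N : lmodType R) (f : {linear N -> M}) s v :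
  (forall v : N, X *: v = 0 -> v = 0) ->
  stable v -> f (smul s v) = smul s (f v).
Proof.
move=> NXinj sv; apply/esym/smulE => //; first exact: stable_linear.
by rewrite -!linearZ smulP.
Qed.

Definition stable_sub : submodule EM.
Proof.
exists (fun v : EM => stable (v : M)) => [|a u v su sv]; first exact: stable0.
by apply: stableD => //; exact: (@stable_linear M (End_fun a)).
Defined.

Notation L := (smod stable_sub).

Definition lval (l : L) : M := smval l.

Definition lmk (v : M) (sv : stable v) : L := @Smod _ _ stable_sub v sv.

Lemma lmkK v (sv : stable v) : lval (lmk sv) = v. Proof. by []. Qed.

Lemma lvalP l : stable (lval l). Proof. exact: (smvalP l). Qed.

Lemma lval_inj : injective lval. Proof. exact: smval_inj. Qed.

Lemma lvalZ (f : E) l : lval (f *: l) = End_fun f (lval l). Proof. by []. Qed.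

Lemma lvalD l l' : lval (l + l') = lval l + lval l'. Proof. by []. Qed.

Lemma op1_linear (pi : {linear M -> R^o}) (v : M) : linear (fun w => (pi w : R) *: v).
Proof. by move=> a x y; rewrite linearP scalerDl -scalerA. Qed.

Definition op1 pi v : E := endo (mklin (op1_linear pi v)).

Lemma op1E pi v w : End_fun (op1 pi v) w = (pi w : R) *: v. Proof. by []. Qed.

Lemma op1_EM_linear pi : linear (op1 pi : EM -> E^o).
Proof.
move=> a u v; apply: End_ringP => w.
rewrite End_addE End_mulE !op1E scalerDr; congr (_ + _).
by rewrite [RHS]linearZ.
Qed.

Lemma op2_linear (pi : {linear M -> S}) (l : L) :
  linear (fun w => smul (pi w) (lval l)).
Proof.
move=> a x y; rewrite linearP smulDl ?smul_phiM //; exact: lvalP.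
Qed.

Definition op2 pi l : E := endo (mklin (op2_linear pi l)).

Lemma op2E pi l w : End_fun (op2 pi l) w = smul (pi w) (lval l). Proof. by []. Qed.

Lemma op2_L_linear pi : linear (op2 pi : L -> E^o).
Proof.
move=> a u v; apply: End_ringP => w.
rewrite End_addE End_mulE !op2E lvalD lvalZ smulDr //; last first.
- exact: lvalP.
- exact/stable_linear/lvalP.
by rewrite smul_linear_map //; exact: lvalP.
Qed.

(** M is the left ideal of E generated by the projection onto R g: [op1 pi] embeds it and evaluation
    at g retracts E onto it. *)
Lemma projective_End_module (g : M) (pi : {linear M -> R^o}) :
  pi g = 1 -> is_projective EM.
Proof.
move=> pig.
have evlin : linear (fun f : E^o => End_fun f g : EM) by [].
apply: (@projective_retract _ EM E^o (mklin (op1_EM_linear pi)) (mklin evlin)).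
  by move=> v; transitivity ((pi g : R) *: (v : M)); [|rewrite pig scale1r].
exact: projective_regular.
Qed.

(** L is the left ideal E e with e = iota pi: [op2 pi] embeds it and evaluation at iota 1 retracts E
    onto it. *)
Lemma projective_stable (iota : {linear S -> M}) (pi : {linear M -> S}) :
  (forall s, pi (iota s) = s) -> is_projective L.
Proof.
move=> iotaK; have s1 := stable_linear iota (stable_normalization (1 : fps k)).
have evlin : linear (fun f : E^o => (f : E) *: lmk s1) .
  by move=> a f f'; rewrite scalerDl scalerA.
apply: (@projective_retract _ L E^o (mklin (op2_L_linear pi)) (mklin evlin)).
  move=> l; apply: lval_inj.
  transitivity (smul (pi (iota (1 : fps k))) (lval l)); first by [].
  by rewrite iotaK smul1 //; exact: lvalP.
exact: projective_regular.
Qed.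

End StableSubmodule.

(** * Upper bounds on the global dimension *)

Section Syzygies.
Variables (k : fieldType) (M : lmodType (cusp_ring k)).
Notation R := (cusp_ring k).
Notation S := (normalization k).
Notation phi := (@phi k).
Notation t := (@fps_t k).
Notation E := (End_ring M).
Notation EM := (End_module M).
Notation L := (smod (stable_sub M)).
Variables (I : finType) (p : pred I) (g : I -> M)
  (v1 : I -> {linear M -> R^o}) (u2 : I -> {linear S -> M})
  (v2 : I -> {linear M -> S}).
Hypothesis Mdec : decomposition p g v1 u2 v2.
Hypothesis Xinj : forall v : M, X *: v = 0 -> v = 0.
Variable i0 : I.
Hypothesis pi0 : p i0.
Variables (n : nat) (gen : 'I_n -> M).
Hypothesis genP : forall v, exists a : 'I_n -> R, v = \sum_i a i *: gen i.
Variables (C0 : eqType) (K : submodule (dsum C0 (E^o))).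
Notation F := (dsum C0 (E^o)).

Local Notation iota := (u2 i0).
Local Notation pi := (v2 i0).

Let iotaK s : pi (iota s) = s. Proof. by case: Mdec => _ _; apply. Qed.

Let op1 := @op1 k M.
Let op2 := @op2 k M Xinj.

Lemma End_eq_gen (f f' : {linear M -> S}) :
  (forall j, f (gen j) = f' (gen j)) -> f =1 f'.
Proof.
move=> ff' v; have [a ->] := genP v; rewrite !linear_sum; apply: eq_bigr => j _.
by rewrite !linearZ ff'.
Qed.

Fact br_linear (s : S) : linear (fun w => iota ((s : fps k) * (pi w : fps k) : fps k)).
Proof.
move=> a x y; rewrite -linearP; congr (iota _).
by rewrite linearP mulrDr normalization_scaleE mulrCA.
Qed.

(** Realizes S as e E e; in particular [br 1] is the idempotent e, and [br 1 *: f = f] says that f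
    lies in e F. *)
Definition br s : E := endo (mklin (br_linear s)).

Lemma brE s w : End_fun (br s) w = iota ((s : fps k) * (pi w : fps k) : fps k).
Proof. by []. Qed.

Lemma brD s s' : br (s + s') = br s + br s'.
Proof. by apply: End_ringP => w; rewrite End_addE !brE -linearD -mulrDl. Qed.

Lemma brM s s' : br (s * s' : fps k) = br s * br s'.
Proof. by apply: End_ringP => w; rewrite End_mulE !brE iotaK mulrA. Qed.

Let act (s : fps k) (f : F) : F := br s *: f.

Lemma scale_fE (a : E) (f : F) c : (a *: f) c = a * (f c : E). Proof. by []. Qed.

Lemma subr_fE (f f' : F) c : (f - f') c = f c - f' c. Proof. by []. Qed.

Definition coord (f : F) (x : C0 * 'I_n) : fps k := pi (End_fun (f x.1 : E) (gen x.2)).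

Lemma coord_act s f x : coord (act s f) x = s * coord f x.
Proof. by rewrite /coord scale_fE End_mulE brE iotaK. Qed.

Lemma coordB f f' x : coord (f - f') x = coord f x - coord f' x.
Proof. by rewrite /coord subr_fE -linearB. Qed.

Lemma coord_inj f : br 1 *: f = f -> (forall x, coord f x = 0) -> f = 0.
Proof.
move=> ef f0; apply: dsumP => c; apply: End_ringP => w.
rewrite -ef scale_fE End_mulE brE mul1r.
have -> : pi (End_fun (f c : E) w) = 0; last by rewrite linear0.
pose h : {linear M -> S} := [the {linear M -> S} of pi \o End_fun (f c : E)].
have zlin : linear (fun _ : M => 0 : S) by move=> a x y; rewrite scaler0 addr0.
apply: (@End_eq_gen h (mklin zlin)) => j.
exact: (f0 (c, j)).
Qed.

(* The S-module e K, e = iota pi, embeds into a direct sum of copies of S by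
   evaluation at the generators of M, so it is free: filter by leading terms. *)
Let W (f : F) := K f /\ br 1 *: f = f.

Lemma stable_component_free : exists (C : eqType) (b : C -> F),
  [/\ forall c, W (b c),
      forall w, W w -> exists f, w = lincomb act b f
    & forall f, lincomb act b f = 0 -> f = 0].
Proof.
have [lt [lt_irr lt_trans lt_tot lt_wf]] := well_ordered_rel (C0 * 'I_n)%type.
pose G i v := W v /\ forall j, lt i j -> coord v j = 0.
have W0 : W 0 by split; [exact: sub_set0 | rewrite scaler0].
have WB u v : W u -> W v -> W (u - v).
  by move=> [Ku eu] [Kv ev]; split; [exact: sub_setB | rewrite scalerBr eu ev].
have Wact s v : W v -> W (act s v).
  move=> [Kv ev]; split; first exact: sub_setZ.
  by rewrite /act scalerA -brM mul1r.
have cd0 x : coord 0 x = 0 by rewrite -(subrr 0) coordB subrr.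
have GB i u v : G i u -> G i v -> G i (u - v).
  move=> [Wu u0] [Wv w0]; split=> [|j ij]; first exact: WB.
  by rewrite coordB u0 ?w0 ?subrr.
have Gact i a v : G i v -> G i (act a v).
  move=> [Wv v0]; split=> [|j ij]; first exact: Wact.
  by rewrite coord_act v0 ?mulr0.
have top v : W v -> v <> 0 -> exists2 m, coord v m <> 0 &
    forall j, lt m j -> coord v j = 0.
  move=> [Kv ev] vN0.
  pose s := [seq x <- [seq (c, j) | c <- dsupp v, j <- enum 'I_n] | coord v x != 0].
  have smem x : coord v x != 0 -> x \in s.
    case: x => c j vx; rewrite mem_filter vx /=; apply: allpairs_f.
      apply: mem_dsupp => vc0; move: vx; rewrite /coord /= vc0.
      by rewrite [End_fun _ _]/(0 : M) linear0 eqxx.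
    by rewrite mem_enum.
  have [s0|sN0] := eqVneq s [::].
    case: vN0; apply: coord_inj => // x.
    by apply/eqP/negPn/negP => /smem; rewrite s0.
  have [m ms mmax] := @seq_max _ lt s lt_trans lt_tot sN0.
  exists m; first by apply/eqP; move: ms; rewrite mem_filter => /andP[].
  move=> j mj; apply/eqP/negPn/negP => /smem /mmax jm.
  have : lt j m by apply: jm; apply: contraTneq mj => ->; rewrite lt_irr.
  by move=> /(lt_trans _ _ _ mj); rewrite lt_irr.
have low i v : G i v -> coord v i = 0 -> lower (fun v => v = 0) lt G i v.
  move=> [Wv v0] vi0; have [->|vN0] := pselect (v = 0); first by left.
  have [m vm mmax] := top v Wv vN0; right; exists m => //.
  have [im|/lt_tot[//|im]] := eqVneq m i; first by rewrite im vi0 in vm.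
  by rewrite v0 in vm.
have [|||||||C [b [bW bgen bfree]]] := @filtered_basis (fps k) F act _
    (fun v => v = 0) W _ lt G erefl _ lt_trans lt_tot lt_wf GB Gact.
- by move=> a b v; rewrite /act brD scalerDl.
- by move=> u v -> ->; rewrite subrr.
- by move=> i v ->; split=> // j _; exact: cd0.
- by move=> i v [].
- by move=> i j v ij [Wv v0]; split=> // l /(lt_trans _ _ _ ij); exact: v0.
- move=> w Ww; have [w0|wN0] := pselect (w = 0); [by left|right].
  by have [m _ m0] := top w Ww wN0; exists m.
(* A leading coefficient of least order divides all leading coefficients at i. If it is 0, [G i]
   adds nothing to [lower]; otherwise an element that attains it is the new basis element. *)
- move=> i; pose A (s : fps k) := exists2 v, G i v & s = coord v i.
  have A0 : A 0 by exists 0 => //; split=> // j _; exact: cd0.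
  have [a [b Gb ea] amin] := fps_min_dvd A0.
  have [b0|bN0] := pselect (coord b i = 0).
    left=> v Gv; apply: low => //; have [|c ->] := amin (coord v i); first by exists v.
    by rewrite ea b0 mulr0.
  right; exists b; split=> // [v Gv|s].
    have [|c ec] := amin (coord v i); first by exists v.
    exists c; apply: low; first by apply: GB => //; exact: Gact.
    by rewrite coordB coord_act -ea ec subrr.
  move=> sb; have sb0 : s * coord b i = 0.
    rewrite -coord_act; case: sb => [->|[j ji [_ ->]]] //; exact: cd0.
  by apply: fps_mulf bN0; rewrite mulrC.
- exists C, b; split=> // w /bgen[f /eqP]; rewrite subr_eq0 => /eqP ->; by exists f.
Qed.

Fact scale_right_linear (Z V : lmodType E) (h : {linear Z -> E^o}) (x : V) :
  linear (fun z => (h z : E) *: x).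
Proof. by move=> a u v; rewrite linearP scalerDl -scalerA. Qed.

Let op2L : {linear L -> E^o} := mklin (op2_L_linear Xinj pi).

(** With L identified with E e, right multiplication by x; for x in e F it is the E-linear map that
    sends e to x. *)
Definition lact (x : F) : {linear L -> F} := mklin (scale_right_linear op2L x).

Lemma lactE x l : lact x l = op2 pi l *: x. Proof. by []. Qed.

Section StableCover.
Variables (C : eqType) (b : C -> F).
Hypothesis bW : forall c, W (b c).
Hypothesis bgen : forall w, W w -> exists f, w = lincomb act b f.
Hypothesis bfree : forall f, lincomb act b f = 0 -> f = 0.

Definition stable_cover : {linear dsum C L -> F} :=
  mklin (dsum_ext_linear (fun c => lact (b c))).

Lemma stable_coverE f : stable_cover f = dsum_ext (fun c l => op2 pi l *: b c) f.
Proof. by []. Qed.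

Fact iota_stable (s : S) : stable (iota s).
Proof. exact/stable_linear/stable_normalization. Qed.

Definition liota (s : S) : L := lmk (iota_stable s).

Lemma op2_liota s : op2 pi (liota s) = br s.
Proof.
apply: End_ringP => w; rewrite op2E brE -smul_linear_map //;
  [|exact: normalization_torsion_free|exact: stable_normalization].
congr (iota _); apply: (X_inj (@normalization_torsion_free k)).
rewrite smulP; last exact: stable_normalization.
by rewrite !normalization_scaleE phi_X phi_rho; ring.
Qed.

Lemma liota0 : liota 0 = 0.
Proof. by apply: lval_inj; rewrite /= linear0. Qed.

Definition dliota (f : dsum C (fps k)^o) : dsum C L :=
  @dmap _ _ C (fps k)^o L liota liota0 f.

(** The part e L is iota S, and there the cover is the expansion in the S-basis [b]. *)
Lemma stable_cover_liota f : stable_cover (dliota f) = lincomb act b f.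
Proof.
rewrite stable_coverE dsum_ext_map; last first.
  by move=> c x y; rewrite -!lactE linearD.
by apply: eq_dsum_ext => c; rewrite op2_liota.
Qed.

Lemma stable_cover_K f : K (stable_cover f).
Proof.
rewrite stable_coverE /dsum_ext; elim/big_ind: _ => [|u v|c _].
- exact: sub_set0.
- exact: sub_setD.
- by apply: sub_setZ; case: (bW c).
Qed.

Lemma stable_cover_W w : W w -> exists f, stable_cover f = w.
Proof. by move=> /bgen[f ->]; exists (dliota f); exact: stable_cover_liota. Qed.

(** The endomorphism iota tau carries the relation [f] into e L, where freeness of [b] applies. *)
Lemma stable_cover_ker (tau : {linear M -> S}) f c :
  stable_cover f = 0 -> tau (lval (f c)) = 0.
Proof.
move=> f0; pose a : E := endo [the {linear M -> M} of iota \o tau].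
pose h (l : L) : (fps k)^o := tau (lval l).
have h0 : h 0 = 0 by exact: linear0.
have: lincomb act b (dmap h0 f) = 0.
  rewrite -stable_cover_liota -[RHS](scaler0 _ a) -f0 -linearZ.
  congr (stable_cover _); apply: dsumP => d; apply: lval_inj.
  by rewrite dsumZE lvalZ.
by move=> /bfree/(congr1 (fun f : dsum _ _ => f c)).
Qed.

Lemma stable_cover_inj : injective stable_cover.
Proof.
move=> f f' /eqP; rewrite -subr_eq0 -linearB => /eqP e; apply/eqP.
rewrite -subr_eq0; apply/eqP; move: (f - f') e => {f f'} f e.
(* An element of M is determined by its images in S: the coordinates [v2 i], and the coordinates
   [v1 i] followed by the inclusion [phi] of R in S. *)
have phi_lin : linear (phi : R^o -> S) by move=> a x y; rewrite rmorphD rmorphM.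
apply: dsumP => c; apply: lval_inj; case: Mdec => /(_ (lval (f c))) -> _ _.
rewrite !big1 ?addr0 // => i _.
  by rewrite (@stable_cover_ker (v2 i) f c e) linear0.
have := @stable_cover_ker [the {linear M -> S} of mklin phi_lin \o v1 i] f c e.
rewrite /= -[0 in RHS](rmorph0 phi) => /phi_inj ->; exact: scale0r.
Qed.

End StableCover.

Lemma End_sumE (J : Type) (r : seq J) (P : pred J) (a : J -> E) w :
  End_fun (\sum_(j <- r | P j) a j) w = \sum_(j <- r | P j) End_fun (a j) w.
Proof. by elim/big_ind2: _ => // x y x' y' <- <-. Qed.

(** The identity of M is the sum of the projections onto its summands. Those onto a copy of S factor
    through e, so e K takes care of all of them. *)
Lemma full_submodule (J : submodule F) : (forall w, W w -> J w) ->
  (forall i v, ~~ p i -> K v -> J (op1 (v1 i) (g i) *: v)) ->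
  forall v, K v -> J v.
Proof.
move=> JW Jg v Kv.
have E1 : (1 : E) = \sum_(i | ~~ p i) op1 (v1 i) (g i) +
    \sum_(i | p i) endo [the {linear M -> M} of u2 i \o v2 i].
  apply: End_ringP => w; rewrite End_addE !End_sumE.
  by case: Mdec => /(_ w) {1}-> _ _.
rewrite -[v]scale1r E1 scalerDl !scaler_suml; apply: sub_setD.
  by elim/big_ind: _ => [|x y|i pi]; [exact: sub_set0|exact: sub_setD|exact: Jg].
elim/big_ind: _ => [|x y|i pi1]; [exact: sub_set0|exact: sub_setD|].
have -> : endo [the {linear M -> M} of u2 i \o v2 i] =
    endo [the {linear M -> M} of u2 i \o pi] *
    endo [the {linear M -> M} of iota \o v2 i].
  by apply: End_ringP => w; rewrite End_mulE !endoE /= iotaK.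
rewrite -scalerA; apply/sub_setZ/JW; split; first exact: sub_setZ.
rewrite scalerA; congr (_ *: _); apply: End_ringP => w.
by rewrite End_mulE brE mul1r !endoE /= iotaK.
Qed.

Lemma syzygy_projective_pure : (forall i, p i) -> is_projective (smod K).
Proof.
move=> pI; have [C [b [bW bgen bfree]]] := stable_component_free.
have [f fP] := smod_lift (stable_cover_K bW).
have fsurj v : K v -> exists x, stable_cover b x = v.
  move: v; apply: (@full_submodule (limage (stable_cover b))) => [w|i v].
    exact: (stable_cover_W bgen).
  by rewrite pI.
have [h hP] := @lin_factor _ (smod K) F (dsum C L) (stable_cover b)
  (@smval _ _ K) (stable_cover_inj bfree) (fun u => fsurj _ (smvalP u)).
apply: (@projective_retract _ _ _ h f) => [x|].
  by apply: smval_inj; rewrite fP hP.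
apply/projective_dsum/(projective_stable Xinj iotaK).
Qed.

(** * Syzygies when R is also a summand *)

Section Mixed.
Variable i1 : I.
Hypothesis pi1 : ~~ p i1.
Local Notation gam := (g i1).
Local Notation pi' := (v1 i1).

Let gamK r : pi' (r *: gam) = r.
Proof.
by rewrite linearZ; case: Mdec => _ /(_ _ pi1) -> _; rewrite [LHS]mulr1.
Qed.

Fact alpha_linear : linear (fun w => rho (pi w : fps k) *: gam).
Proof.
move=> a x y.
by rewrite linearP rhoD normalization_scaleE rho_phiM scalerDl scalerA.
Qed.
(** [alpha] is multiplication by t^2 from the summand S to the summand R, and [beta] below is the
    inclusion of R in S. As [alpha * br s * beta] multiplies the summand R by [rho s], the subgroup
    [U] absorbs the action of m on [W1]. *)
Definition alpha : E := endo (mklin alpha_linear).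
Lemma alphaE w : End_fun alpha w = rho (pi w : fps k) *: gam. Proof. by []. Qed.

Fact beta_linear : linear (fun w => iota (phi (pi' w : R))).
Proof.
move=> a x y; rewrite -linearP; congr (iota _).
by rewrite linearP rmorphD rmorphM.
Qed.
Definition beta : E := endo (mklin beta_linear).
Lemma betaE w : End_fun beta w = iota (phi (pi' w : R)). Proof. by []. Qed.

(** The coefficient field k inside e' E e' = R, where e' = [ea 1] is the projection onto the summand
    R. *)
Definition ea (a : k) : E := op1 pi' (kap a *: gam).
Lemma eaE a w : End_fun (ea a) w = (pi' w : R) *: (kap a *: gam). Proof. by []. Qed.

Lemma eaD a a' : ea (a + a') = ea a + ea a'.
Proof.
by apply: End_ringP => w; rewrite End_addE !eaE -scalerDr -scalerDl -kapD.
Qed.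

Lemma eaM a a' : ea (a * a') = ea a * ea a'.
Proof.
apply: End_ringP => w; rewrite End_mulE !eaE !scalerA gamK; congr (_ *: _).
by rewrite kapM; ring.
Qed.

Let W1 (f : F) := K f /\ ea 1 *: f = f.
Let U (f : F) := exists2 w, W w & f = alpha *: w.
Let act1 (a : k) (f : F) : F := ea a *: f.

Let W0 : W 0.
Proof. by split; [exact: sub_set0 | rewrite scaler0]. Qed.

Let WB u v : W u -> W v -> W (u - v).
Proof.
by move=> [Ku eu] [Kv ev]; split; [exact: sub_setB | rewrite scalerBr eu ev].
Qed.

Let Wbr s v : W v -> W (br s *: v).
Proof.
by move=> [Kv ev]; split; [exact: sub_setZ | rewrite scalerA -brM mul1r].
Qed.

Let U0 : U 0. Proof. by exists 0; rewrite ?scaler0. Qed.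

Let UB u v : U u -> U v -> U (u - v).
Proof.
move=> [u' Wu ->] [v' Wv ->]; exists (u' - v'); first exact: WB.
by rewrite scalerBr.
Qed.

Let UD u v : U u -> U v -> U (u + v).
Proof. by move=> Uu Uv; rewrite -[v]opprK -[- v]add0r; do 2?apply: UB. Qed.

Let ea_alpha a : ea a * alpha = alpha * br (cst a).
Proof.
apply: End_ringP => w; rewrite !End_mulE eaE !alphaE brE iotaK gamK scalerA.
by rewrite rho_cst mulrC.
Qed.

Let Uact a v : U v -> U (act1 a v).
Proof.
move=> [w Ww ->]; exists (br (cst a) *: w); first exact: Wbr.
by rewrite /act1 !scalerA ea_alpha.
Qed.

Let UW1 v : U v -> W1 v.
Proof.
have cst1 : cst 1 = 1 :> fps k by apply: fpsP => -[|i].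
move=> [w [Kw ew] ->]; split; first exact: sub_setZ.
by rewrite scalerA ea_alpha cst1 -scalerA ew.
Qed.

(** A basis of the k-vector space W1 / U: well-order F and keep each element of [W1] that is not in
    the span of [U] and its predecessors. *)
Lemma residue_basis : exists (D : eqType) (d : D -> F),
  [/\ forall c, W1 (d c),
      forall w, W1 w -> exists f, U (w - lincomb act1 d f)
    & forall f, U (lincomb act1 d f) -> f = 0].
Proof.
have [lt [lt_irr lt_trans lt_tot lt_wf]] := well_ordered_rel F.
have actD a a' v : act1 (a + a') v = act1 a v + act1 a' v.
  by rewrite /act1 eaD scalerDl.
have actB a u v : act1 a (u - v) = act1 a u - act1 a v by rewrite /act1 scalerBr.
have actA a a' v : act1 a (act1 a' v) = act1 (a * a') v.
  by rewrite /act1 scalerA eaM.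
have act0 v : act1 0 v = 0 by apply: (addrI (act1 0 v)); rewrite -actD !addr0.
pose closed (P : F -> Prop) := (forall u v, P u -> P v -> P (u - v)) /\
  forall a v, P v -> P (act1 a v).
(* The k-span of [U] and of the elements of [W1] up to i, as an intersection of closed predicates:
   membership is used by choosing P. *)
pose G i v := forall P, closed P -> (forall u, U u -> P u) ->
  (forall c, W1 c -> c = i \/ lt c i -> P c) -> P v.
have GB i u v : G i u -> G i v -> G i (u - v).
  by move=> Gu Gv P Pcl PU Pc; case: (Pcl) => PB _; apply: PB; [exact: Gu | exact: Gv].
have Gact i a v : G i v -> G i (act1 a v).
  by move=> Gv P Pcl PU Pc; case: (Pcl) => _ Pa; apply: Pa; exact: Gv.
have UG i v : U v -> G i v by move=> Uv P _ PU _; exact: PU.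
have Glt i j v : lt i j -> G i v -> G j v.
  move=> ij Gv P Pcl PU Pc; apply: Gv => // c Wc ci; apply: (Pc _ Wc); right.
  by case: ci => [->|ci] //; exact: lt_trans ij.
have W1cl : closed W1.
  split=> [u v [Ku eu] [Kv ev]|a v [Kv ev]].
    by split; [exact: sub_setB | rewrite scalerBr eu ev].
  split; first exact: sub_setZ.
  by rewrite -[LHS]/(act1 1 (act1 a v)) actA mul1r.
have GW i v : G i v -> W1 v by move=> Gv; apply: (Gv W1 W1cl UW1).
have Gself i : W1 i -> G i i by move=> Wi P Pcl PU; apply => //; left.
have WG w : W1 w -> U w \/ exists i, G i w.
  by move=> Ww; right; exists w; exact: Gself.
pose F' := lower U lt G.
have F'B i : forall u v, F' i u -> F' i v -> F' i (u - v).
  by move=> u v; apply: lowerB.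
have F'act i a v : F' i v -> F' i (act1 a v).
  by move=> [Uv|[j ji Gv]]; [left; exact: Uact | right; exists j => //; exact: Gact].
have F'lt i c : W1 c -> lt c i -> F' i c by move=> Wc ci; right; exists c; auto.
apply: (filtered_basis actD U0 UB lt_trans lt_tot lt_wf GB Gact UG GW Glt WG) => i.
have [F'i|nF'i] := pselect (W1 i -> F' i i).
  left=> v Gv; apply: (Gv (F' i)) => [|u Uu|c Wc].
  - by split=> [u w|a w]; [exact: F'B|exact: F'act].
  - by left.
  - by case=> [ci|]; [rewrite ci; apply: F'i; rewrite -ci | exact: F'lt].
have [Wi nFi] : W1 i /\ ~ F' i i by apply/not_implyP.
right; exists i; split=> [|v|a Fa]; first exact: Gself.
  move=> Gv; apply: (Gv (fun v => exists a, F' i (v - act1 a i))) => [|u Uu|c Wc].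
  - split=> [u w [a Fa] [a' Fa']|a u [a' Fa']].
      exists (a - a'); have := F'B _ _ _ Fa Fa'; congr (F' i _).
      have -> : act1 (a - a') i = act1 a i - act1 a' i.
        by apply/eqP; rewrite eq_sym subr_eq -actD subrK.
      by rewrite !opprB [LHS]addrACA [RHS]addrACA [- act1 a i + _]addrC.
    by exists (a * a'); rewrite -actA -actB; exact: F'act.
  - by exists 0; rewrite act0 subr0; left.
  - case=> [->|ci]; last by exists 0; rewrite act0 subr0; exact: F'lt.
    by exists 1; case: Wi => _; rewrite /act1 => ->; rewrite subrr; left.
apply: contrapT => /eqP a0; apply: nFi.
by have := F'act i a^-1 _ Fa; rewrite actA mulVf //; case: Wi => _ e; rewrite /act1 e.
Qed.

Section MixedCover.
Variables (C : eqType) (b : C -> F).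
Hypothesis bW : forall c, W (b c).
Hypothesis bgen : forall w, W w -> exists f, w = lincomb act b f.
Hypothesis bfree : forall f, lincomb act b f = 0 -> f = 0.
Variables (D : eqType) (d : D -> F).
Hypothesis dW : forall c, W1 (d c).
Hypothesis dgen : forall w, W1 w -> exists f, U (w - lincomb act1 d f).
Hypothesis dfree : forall f, U (lincomb act1 d f) -> f = 0.

Local Notation P1 := (dsum C L * dsum D EM)%type.

Let op1L : {linear EM -> E^o} := mklin (op1_EM_linear pi').

Definition ract (x : F) : {linear EM -> F} := mklin (scale_right_linear op1L x).

Lemma ractE x (m : EM) : ract x m = op1 pi' m *: x. Proof. by []. Qed.

Definition residue_cover : {linear dsum D EM -> F} :=
  mklin (dsum_ext_linear (fun c => ract (d c))).

Lemma residue_coverE f :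
  residue_cover f = dsum_ext (fun c (m : EM) => op1 pi' m *: d c) f.
Proof. by []. Qed.

Fact mixed_cover_linear : linear (fun x : P1 => stable_cover b x.1 + residue_cover x.2).
Proof.
move=> a x y; rewrite scalerDr addrACA; congr (_ + _); exact: linearP.
Qed.
Definition mixed_cover : {linear P1 -> F} := mklin mixed_cover_linear.

Lemma mixed_coverE x : mixed_cover x = stable_cover b x.1 + residue_cover x.2.
Proof. by []. Qed.

Lemma mixed_cover_K x : K (mixed_cover x).
Proof.
rewrite mixed_coverE; apply: sub_setD; first exact: stable_cover_K.
rewrite residue_coverE /dsum_ext; elim/big_ind: _ => [|u v|c _].
- exact: sub_set0.
- exact: sub_setD.
- by apply: sub_setZ; case: (dW c).
Qed.

Lemma mixed_cover_surj v : K v -> exists x, mixed_cover x = v.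
Proof.
pose J := limage mixed_cover.
have JW w : W w -> J w.
  move=> /(stable_cover_W bgen)[f <-]; exists (f, 0).
  by rewrite mixed_coverE linear0 addr0.
have JU u : U u -> J u by move=> [w /JW Jw ->]; exact: sub_setZ.
have Jd c (m : EM) : J (op1 pi' m *: d c).
  exists (0, single c m); rewrite mixed_coverE linear0 add0r residue_coverE.
  rewrite (@dsum_ext_single _ D EM) // => c' x y.
  by rewrite -!ractE linearD.
apply: (full_submodule JW) => i {}v npi Kv.
(* The projection onto the i-th copy of R factors through the chosen copy, where the basis [d] is
   available. *)
pose a : E := op1 (v1 i) gam.
have -> : op1 (v1 i) (g i) = op1 pi' (g i) * a.
  by apply: End_ringP => w; rewrite End_mulE !op1E gamK.
rewrite -scalerA; apply: sub_setZ.
have [|f Uf] := @dgen (a *: v).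
  split; first exact: sub_setZ.
  rewrite scalerA; congr (_ *: _); apply: End_ringP => w.
  by rewrite End_mulE eaE !op1E gamK kap1 scale1r.
rewrite -[a *: v](subrK (lincomb act1 d f)); apply: sub_setD; first exact: JU.
rewrite /lincomb /dsum_ext; elim/big_ind: _ => [|x y|c _].
- exact: sub_set0.
- exact: sub_setD.
- exact: Jd.
Qed.

Let betaW x : W1 x -> W (beta *: x).
Proof.
move=> [Kx ex]; split; first exact: sub_setZ.
rewrite scalerA; congr (_ *: _); apply: End_ringP => w.
by rewrite End_mulE brE mul1r betaE iotaK.
Qed.

Let sd_ex : exists sd : D -> dsum C (fps k)^o,
  forall c, beta *: d c = lincomb act b (sd c).
Proof.
by have /choice[sd sdP] c := bgen (betaW (dW c)); exists sd.
Qed.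
Let sd := sval (cid sd_ex).
Let sdP c : beta *: d c = lincomb act b (sd c).
Proof. exact: (svalP (cid sd_ex)). Qed.

Definition lsmul (l : L) (s : fps k) : L := lmk (stable_smul Xinj s (lvalP l)).

Lemma lsmul0 l : lsmul l 0 = 0.
Proof. by apply: lval_inj; rewrite lmkK smul0 //; exact: lvalP. Qed.

Definition dlsmul (f : dsum C (fps k)^o) (l : L) : dsum C L :=
  @dmap _ _ C (fps k)^o L (lsmul l) (lsmul0 l) f.

Fact dlsmul_linear f : linear (dlsmul f).
Proof.
move=> a l l'; apply: dsumP => c; apply: lval_inj.
transitivity (smul (f c) (End_fun a (lval l) + lval l')); first by [].
transitivity (End_fun a (smul (f c) (lval l)) + smul (f c) (lval l')); last by [].
rewrite smulDr //; last exact: lvalP; last exact/stable_linear/lvalP.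
by rewrite smul_linear_map //; exact: lvalP.
Qed.

(** For l in L, [op1 pi' l *: d c] equals [op2 pi l *: (beta *: d c)], hence it also comes from
    L^(C), by scaling l with the S-coordinates [sd c] of [beta *: d c]. The syzygies are these
    coincidences. *)
Definition syzygy_map1 : {linear dsum D L -> dsum C L} :=
  mklin (dsum_ext_linear (fun c => mklin (dlsmul_linear (sd c)))).

Let lvalEM0 : lval 0 = 0 :> EM. Proof. by []. Qed.

Definition syzygy_map2 (f : dsum D L) : dsum D EM :=
  @dmap _ _ D L EM (@lval k M) lvalEM0 f.

Fact syzygy_map_linear :
  linear (fun f : dsum D L => (- syzygy_map1 f, syzygy_map2 f) : P1).
Proof.
move=> a f f'; congr pair.
  by rewrite linearP opprD -scalerN.
exact: dsumP.
Qed.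
Definition syzygy_map : {linear dsum D L -> P1} := mklin syzygy_map_linear.

Lemma syzygy_mapE f : syzygy_map f = (- syzygy_map1 f, syzygy_map2 f).
Proof. by []. Qed.

Lemma syzygy_map1E f : syzygy_map1 f = dsum_ext (fun c => dlsmul (sd c)) f.
Proof. by []. Qed.

Lemma syzygy_map_inj : injective syzygy_map.
Proof.
move=> f f' [_ e]; apply: dsumP => c; apply: lval_inj.
exact: (congr1 (@^~ c) e).
Qed.

Lemma stable_cover_dlsmul f l :
  stable_cover b (dlsmul f l) = op2 pi l *: lincomb act b f.
Proof.
rewrite stable_coverE /lincomb dsum_ext_map; last first.
  by move=> c x y; rewrite -!lactE linearD.
rewrite (@dsum_ext_morph _ _ _ _ _ _ (fun x => op2 pi l *: x)); last exact: scaler0.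
  apply: eq_dsum_ext => c; rewrite /act scalerA; congr (_ *: _).
  apply: End_ringP => w; rewrite End_mulE !op2E brE iotaK lmkK smulA ?[_ * f c]mulrC //.
  exact: lvalP.
by move=> x y; rewrite scalerDr.
Qed.

(** Since l is in L, the map R -> M that takes 1 to l extends to S, i.e. factors through the
    inclusion of R in S. *)
Lemma op2_beta l : op2 pi l * beta = op1 pi' (lval l).
Proof.
apply: End_ringP => w; rewrite End_mulE betaE op2E op1E iotaK smul_phi //.
exact: lvalP.
Qed.

Lemma mixed_cover_syzygy f : mixed_cover (syzygy_map f) = 0.
Proof.
rewrite mixed_coverE syzygy_mapE [stable_cover b _]linearN.
apply/eqP; rewrite addrC subr_eq0; apply/eqP; rewrite syzygy_map1E /syzygy_map2.
rewrite residue_coverE dsum_ext_map; last first.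
  by move=> c x y; rewrite -!ractE linearD.
rewrite (@dsum_ext_morph _ _ _ _ _ _ (stable_cover b)); [|exact: linearD|exact: linear0].
by apply: eq_dsum_ext => c; rewrite stable_cover_dlsmul -sdP scalerA op2_beta.
Qed.

Lemma op2_U (l : L) s (w : F) : lval l = rho s *: gam -> W w -> U (op2 pi l *: w).
Proof.
move=> el Ww; exists (br s *: w); first exact: Wbr.
rewrite scalerA; congr (_ *: _); apply: End_ringP => w'.
by rewrite End_mulE op2E alphaE brE iotaK el smul_rho // mulrC.
Qed.

Lemma stable_coef (m : M) i : stable m -> exists s, (v1 i m : R) = rho s.
Proof.
move=> [m' em]; apply: (@XY_conductor _ _ (v1 i m')).
have := congr1 (v1 i) em; rewrite !linearZ => e.
exact: (esym e).
Qed.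

Lemma mixed_cover_ker x : mixed_cover x = 0 -> exists f, syzygy_map f = x.
Proof.
case: x => [l m] e0.
(* Apply [op1 (v1 i) gam] to the relation. The part from L falls into [U]; the rest is, modulo [U],
   the combination of the [d c] with the constant coefficients of [v1 i (m c)]. These vanish by
   [dfree], so the R-coordinates of [m c] lie in m. *)
have m_stable c : stable (m c : M).
  case: Mdec => /(_ (m c)) -> _ _; apply: stableD; last first.
    elim/big_ind: _ => [|x y|i _]; [exact: stable0|exact: stableD|].
    exact/stable_linear/stable_normalization.
  elim/big_ind: _ => [|x y|i npi]; [exact: stable0|exact: stableD|].
  pose a : E := op1 (v1 i) gam.
  pose h (x : EM) : k^o := coef (phi (v1 i x : R)) 0.
  have h0 : h 0 = 0 by rewrite /h linear0 rmorph0.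
  suff : dmap h0 m = 0.
    move=> m0; have hmc : coef (phi (v1 i (m c) : R)) 0 = 0.
      by rewrite -[LHS]/(dmap h0 m c) m0.
    have [s ->] := rho_surj hmc; exact: stable_rho.
  apply: dfree.
  have Ul : U (stable_cover b (a *: l)).
    rewrite stable_coverE /dsum_ext; elim/big_ind: _ => [|x y|c' _] //; first exact: UD.
    have [s es] := stable_coef i (lvalP (l c')).
    by apply: (@op2_U _ s) => //; rewrite dsumZE lvalZ op1E es.
  have Um : U (residue_cover (a *: m)).
    have aE : mixed_cover (a *: (l, m)) = a *: mixed_cover (l, m) by exact: linearZ.
    have : U (mixed_cover (a *: (l, m))) by rewrite aE e0 scaler0.
    rewrite mixed_coverE => /UB/(_ Ul); by rewrite addrAC subrr add0r.
  have -> : lincomb act1 d (dmap h0 m) = residue_cover (a *: m) -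
      (residue_cover (a *: m) - lincomb act1 d (dmap h0 m)).
    by rewrite opprB addrC subrK.
  apply: UB => //.
  have -> : a *: m = dmap (scaler0 _ a) m by exact: dsumP.
  rewrite residue_coverE /lincomb !dsum_ext_map; last first.
  - by move=> c' x y; rewrite /act1 eaD scalerDl.
  - by move=> c' x y; rewrite -!ractE linearD.
  rewrite /dsum_ext -sumrB; elim/big_ind: _ => [|x y|c' _] //; first exact: UD.
  (* Split the coordinate into its residue and [rho s]; the latter acts on [d c'] as
     [alpha * br s * beta], with result in [U]. *)
  have [s es] := cusp_decomp (v1 i (m c')).
  exists (br s *: (beta *: d c')); first exact/Wbr/betaW.
  rewrite /act1 -scalerBl !scalerA; congr (_ *: _).
  apply/eqP; rewrite subr_eq; apply/eqP; apply: End_ringP => w.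
  rewrite End_addE !End_mulE eaE op1E alphaE brE betaE !iotaK.
  rewrite -[a *: _]/((v1 i (m c') : R) *: gam) es !scalerA -scalerDl.
  by rewrite mulrDr addrC [s * _]mulrC rho_phiM.
have f_finite : exists s : seq D, forall c, lmk (m_stable c) <> 0 -> c \in s.
  have [s sP] := dsum_finite m; exists s => c fc; apply: sP => mc; apply: fc.
  exact: lval_inj.
pose f : dsum D L := Dsum f_finite.
exists f; apply/esym/eqP; rewrite -subr_eq0; apply/eqP.
(* Subtracting the syzygy of [f] leaves a relation supported on L^(C), where the cover is
   injective. *)
have e2 : m - syzygy_map2 f = 0 by apply: dsumP => c; rewrite dsumBE subrr.
have : mixed_cover ((l, m) - syzygy_map f) = 0.
  by rewrite linearB e0 mixed_cover_syzygy subrr.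
rewrite syzygy_mapE.
have -> : (l, m) - (- syzygy_map1 f, syzygy_map2 f) = (l + syzygy_map1 f, 0).
  by rewrite -e2 -[X in l + X]opprK.
rewrite mixed_coverE [residue_cover _]linear0 addr0 => e; congr pair.
by apply: (stable_cover_inj bfree); rewrite e linear0.
Qed.

End MixedCover.
Lemma syzygy_pd_mixed : pd_le (smod K) 1.
Proof.
have [C [b [bW bgen bfree]]] := stable_component_free.
have [D [d [dW dgen dfree]]] := residue_basis.
have [q qP] := smod_lift (mixed_cover_K bW dW).
apply/pd_leS.
exists (dsum D L), (dsum C L * dsum D EM)%type, (syzygy_map bgen dW), q.
have Lproj := projective_stable Xinj iotaK.
have EMproj : is_projective EM.
  by apply: (@projective_End_module _ _ gam pi'); case: Mdec => _ e _; exact: e.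
split; last exact/pd_le0/projective_dsum.
  by apply: projective_prod; exact: projective_dsum.
split; first exact: syzygy_map_inj.
  move=> x; have [y ey] := mixed_cover_surj bgen dgen (smvalP x).
  by exists y; apply: smval_inj; rewrite qP.
have q0 y : q y = 0 <-> mixed_cover b d y = 0.
  rewrite -qP; split=> [->|qy0]; [exact: linear0|exact: smval_inj].
move=> y; rewrite q0; split=> [|[z <-]]; first exact: mixed_cover_ker.
exact: mixed_cover_syzygy.
Qed.

End Mixed.
End Syzygies.

Section GlobalDimension.
Variables (k : fieldType) (M : lmodType (cusp_ring k)).
Variables (I : finType) (p : pred I) (g : I -> M)
  (v1 : I -> {linear M -> (cusp_ring k)^o})
  (u2 : I -> {linear normalization k -> M})
  (v2 : I -> {linear M -> normalization k}).
Hypothesis Mdec : decomposition p g v1 u2 v2.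
Hypothesis Xinj : forall v : M, X *: v = 0 -> v = 0.
Hypothesis Mfg : fin_gen M.

Lemma syzygy_gldim n : (forall (N : lmodType (End_ring M))
    (K : submodule (dsum N (End_ring M)^o)), pd_le (smod K) n) ->
  gldim_le (End_ring M) n.+1.
Proof.
move=> pdK N; have [q qsurj] := free_cover N; apply/pd_leS.
exists (smod (kerm q)), (dsum N (End_ring M)^o), (@smval _ _ (kerm q)), q.
split; [exact/projective_dsum/projective_regular | exact: ker_exact | exact: pdK].
Qed.

Lemma gldim_le1 (i0 : I) : (forall i, p i) -> gldim_le (End_ring M) 1.
Proof.
move=> pI; apply: syzygy_gldim => N K; apply/pd_le0.
have [n [gen genP]] := Mfg.
exact: (syzygy_projective_pure Mdec Xinj (pI i0) genP).
Qed.

Lemma gldim_le2 i0 i1 : p i0 -> ~~ p i1 -> gldim_le (End_ring M) 2.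
Proof.
move=> pi0 pi1; apply: syzygy_gldim => N K; have [n [gen genP]] := Mfg.
exact: (syzygy_pd_mixed Mdec Xinj pi0 genP _ pi1).
Qed.

End GlobalDimension.

(** * Lower bounds on the global dimension *)

(** A section of A -> A / A s sends the class of 1 to some e congruent to 1 modulo A s; as s kills
    that class, s e = 0. *)
Lemma gldim_le0_split (A : pzRingType) (s : A) : gldim_le A 0 ->
  exists e a, s * e = 0 /\ 1 = e + a * s.
Proof.
move=> gl0.
have I_sub : {I : submodule A^o | forall x, I x <-> exists a, x = a * s}.
  unshelve eexists; first exists (fun x : A^o => exists a : A, x = a * s).
  - by exists 0; rewrite mul0r.
  - move=> a _ _ [x ->] [y ->]; exists (a * x + y).
    by rewrite mulrDl -mulrA.
  - by [].
have [I IP] := I_sub.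
have proj : is_projective (qmod I) by apply/pd_le0/gl0.
have [h hP] := proj _ _ (@qproj _ _ I) [the {linear qmod I -> qmod I} of idfun]
  (@qproj_surj _ _ I).
pose e : A := h (qproj I 1).
have /qproj_eq/IP[a ea] : qproj I e = qproj I 1 by rewrite hP.
exists e, (- a); split.
  transitivity (h (s *: qproj I 1) : A); first by rewrite linearZ.
  rewrite (_ : s *: qproj I 1 = 0) ?linear0 // -(linear0 (@qproj _ _ I)).
  transitivity (qproj I (s *: (1 : A^o))); first by rewrite linearZ.
  by apply/qproj_eq/IP; exists 1; rewrite subr0 mul1r [LHS]mulr1.
by rewrite mulNr -ea opprB addrC subrK.
Qed.

Section MaximalIdealSubmodule.
Variables (k : fieldType) (M : lmodType (cusp_ring k)).
Notation R := (cusp_ring k).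
Notation S := (normalization k).
Notation phi := (@phi k).
Notation t := (@fps_t k).
Notation E := (End_ring M).
Notation EM := (End_module M).
Hypothesis Xinj : forall v : M, X *: v = 0 -> v = 0.

Fact scaling_linear (r : R) : linear (fun v : M => r *: v).
Proof. by move=> a u v; rewrite scalerDr !scalerA mulrC. Qed.

Definition scaling r : E := endo (mklin (scaling_linear r)).

Definition max_sub : submodule EM.
Proof.
exists (fun v : EM => exists q r : M, (v : M) = X *: q + Y *: r).
  by exists 0, 0; rewrite !scaler0 addr0.
move=> a _ _ [q [r ->]] [q' [r' ->]].
exists (End_fun a q + q'), (End_fun a r + r').
by rewrite End_module_scaleE linearD !linearZ !scalerDr addrACA.
Defined.

Notation mM := (smod max_sub).

Definition max_mk (q r : M) : mM :=
  @Smod _ _ max_sub (X *: q + Y *: r) (ex_intro _ q (ex_intro _ r erefl)).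

Lemma max_mkE q r : smval (max_mk q r) = X *: q + Y *: r. Proof. by []. Qed.

Fact max_cover_linear : linear (fun x : EM * EM => max_mk x.1 x.2).
Proof.
move=> a [q r] [q' r']; apply: smval_inj; rewrite max_mkE.
transitivity (End_fun a (X *: q + Y *: r) + (X *: q' + Y *: r')); last by [].
transitivity (X *: (End_fun a q + q') + Y *: (End_fun a r + r')); first by [].
by rewrite !scalerDr addrACA [in RHS]linearD ![in RHS]linearZ.
Qed.
Definition max_cover : {linear (EM * EM)%type -> mM} := mklin max_cover_linear.

Lemma max_coverE q r : smval (max_cover (q, r)) = X *: q + Y *: r.
Proof. by []. Qed.

Lemma max_cover_surj z : exists x, max_cover x = z.
Proof.
by case: z => [v [q [r e]]]; exists (q, r); apply: smval_inj; rewrite max_coverE -e.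
Qed.

(** A section h of [max_cover] satisfies X h(Y g) = Y h(X g). By [XY_conductor] both components of
    h(X g) have their R-coordinate in m, which would put X into m^2. *)
Lemma max_sub_not_projective (g : M) (pi : {linear M -> R^o}) :
  pi g = 1 -> ~ is_projective mM.
Proof.
move=> pig proj.
have [h hP] := proj _ _ max_cover [the {linear mM -> mM} of idfun] max_cover_surj.
pose z1 := max_mk g 0; pose z2 := max_mk 0 g.
have e12 : scaling X *: z2 = scaling Y *: z1.
  apply: smval_inj.
  transitivity (X *: (X *: 0 + Y *: g)); first by [].
  transitivity (Y *: (X *: g + Y *: 0)); last by [].
  by rewrite !scaler0 add0r addr0 !scalerA mulrC.
have eh : scaling X *: h z2 = scaling Y *: h z1 by rewrite -!linearZ e12.
have piZ r v : pi (r *: v) = r * (pi v : R) :> R by rewrite linearZ.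
have key (f : {linear (EM * EM)%type -> EM}) : exists s, (pi (f (h z1) : M) : R) = rho s.
  apply: (@XY_conductor _ _ (pi (f (h z2)))).
  have := congr1 f eh; rewrite !linearZ => e.
  have {}e : X *: (f (h z2) : M) = Y *: (f (h z1) : M) by exact: e.
  by rewrite -!piZ e.
have [[s es] [s' es']] := (key fst, key snd).
apply: (@X_notin_square k s s').
have e1 : X *: ((h z1).1 : M) + Y *: ((h z1).2 : M) = X *: g + Y *: 0.
  have := congr1 (fun z : mM => smval z : M) (hP z1 : max_cover (h z1) = z1).
  by case: (h z1).
have := congr1 pi e1; rewrite scaler0 addr0 linearD => e.
have {}e : X * pi (h z1).1 + Y * pi (h z1).2 = X * pi g :> R by rewrite -!piZ.
by rewrite -[LHS]mulr1 -pig -e; congr (_ * _ + _ * _).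
Qed.

Lemma gldim_gt1 (g : M) (pi : {linear M -> R^o}) : pi g = 1 -> ~ gldim_le E 1.
Proof.
move=> pig gl1; apply: (max_sub_not_projective pig).
have [K [P [i [q [Pproj Pex /pd_le0 Kproj]]]]] := (pd_leS _ _).1 (gl1 (qmod max_sub)).
apply: (stable_retract_projective _ Kproj).
have ex : short_exact (@smval _ _ max_sub) (@qproj _ _ max_sub).
  split; [exact: smval_inj | exact: qproj_surj | move=> y].
  rewrite -(linear0 (@qproj _ _ max_sub)) qproj_eq subr0.
  by split=> [my|[z <-]]; [exists (Smod my) | exact: smvalP].
apply: (stable_retract_syzygy ex Pex _ Pproj (stable_retract_refl _)).
exact: projective_End_module pig.
Qed.

Lemma max_sub_rho s (v : M) : max_sub (rho s *: v).
Proof.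
pose s2 := Fps (fun i => coef s (2 + i)).
exists (kap (coef s 0) *: v + rho s2 *: v), (kap (coef s 1) *: v).
rewrite scalerDr !scalerA -!scalerDl; congr (_ *: _); apply: phi_inj.
rewrite !rmorphD !rmorphM phi_X phi_Y !phi_kap !phi_rho.
have -> : t ^+ 2 * s = t ^+ 2 * (cst (coef s 0) + cst (coef s 1) * t + t ^+ 2 * s2).
  by congr (_ * _); exact: fps_expand2.
by ring.
Qed.

Lemma max_sub_stable (z : mM) : stable (smval z : M).
Proof.
case: z => [v [q [r /= ->]]]; apply: stableD; exact: stable_rho.
Qed.

Fact max_syzygy_linear :
  linear (fun z : mM => (- smul t (smval z : M), smval z) : (EM * EM)%type).
Proof.
move=> a z z'; congr pair.
transitivity (- smul t (End_fun a (smval z) + smval z')); first by [].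
transitivity (End_fun a (- smul t (smval z : M)) - smul t (smval z' : M)); last by [].
rewrite linearN -opprD smulDr //; last exact: max_sub_stable.
  by rewrite smul_linear_map //; exact: max_sub_stable.
exact/stable_linear/max_sub_stable.
Qed.
(** The relation t^2 (- t z) + t^3 z = 0, where t z exists in M because m M is contained in L. *)
Definition max_syzygy : {linear mM -> (EM * EM)%type} := mklin max_syzygy_linear.

Lemma max_syzygyE z : max_syzygy z = (- smul t (smval z : M), smval z).
Proof. by []. Qed.

(** For M free, X v + Y w = 0 forces the coordinates of w into m by [XY_conductor]; then w lies in m
    M and v = - t w. *)
Lemma max_sub_periodic (I : finType) (g : I -> M) (v1 : I -> {linear M -> R^o}) :
  (forall m, m = \sum_i (v1 i m : R) *: g i) -> short_exact max_syzygy max_cover.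
Proof.
move=> Mfree; split; last 1 first.
- move=> [v w]; split=> [/(congr1 (@smval _ _ _))|[z <-]]; last first.
    apply: smval_inj; rewrite max_syzygyE max_coverE scalerN smulP.
      by rewrite addNr.
    exact: max_sub_stable.
  rewrite max_coverE => e; have {}e : X *: v + Y *: w = 0 by exact: e.
  have mw : max_sub w.
    rewrite [w](Mfree w); elim/big_ind: _ => [|x y|i _].
    - exact: sub_set0.
    - exact: sub_setD.
    have [|s ->] := @XY_conductor _ (v1 i w) (- v1 i v).
      have := congr1 (v1 i) e; rewrite linearD !linearZ linear0 => /eqP.
      by rewrite addrC addr_eq0 mulrN => /eqP.
    exact: max_sub_rho.
  exists (Smod mw); rewrite max_syzygyE; congr pair.
  apply: (X_inj Xinj); rewrite scalerN smulP; last exact: (max_sub_stable (Smod mw)).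
  by apply/eqP; rewrite eq_sym -addr_eq0 e.
- by move=> z z' [_ /smval_inj].
- exact: max_cover_surj.
Qed.

Lemma gldim_infinite (I : finType) (g : I -> M) (v1 : I -> {linear M -> R^o})
    (i0 : I) n :
  (forall m, m = \sum_i (v1 i m : R) *: g i) -> v1 i0 (g i0) = 1 ->
  ~ gldim_le E n.
Proof.
move=> Mfree e0 /(_ mM).
have EMproj := projective_End_module e0.
(* Generalized to handle arbitrary resolutions: if m M, its own syzygy, is a stable retract of Y, it
   is one of every first syzygy of Y. *)
suff H : forall Y, stable_retract mM Y -> ~ pd_le Y n.
  by apply: H; exact: stable_retract_refl.
elim: n => [|n IHn] Y mY.
  move=> /pd_le0 /(stable_retract_projective mY); exact: max_sub_not_projective e0.
move=> /pd_leS[K [P [i [q [Pproj Pex pdK]]]]]; apply: (IHn K) => //.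
apply: (stable_retract_syzygy (max_sub_periodic Mfree) Pex _ Pproj mY).
exact: projective_prod.
Qed.

End MaximalIdealSubmodule.

(** * Maximal Cohen-Macaulay modules *)

Section KrullDimension.
Variable k : fieldType.
Notation R := (cusp_ring k).
Notation phi := (@phi k).

Definition zero_ideal : {pred R} := fun r => r == 0.
Definition max_ideal : {pred R} := fun r => coef (phi r) 0 == 0.

Fact zero_ideal_closed : idealr_closed zero_ideal.
Proof.
split; rewrite /zero_ideal ?unfold_in ?eqxx ?oner_eq0 // => a u v.
by rewrite !unfold_in => /eqP-> /eqP->; rewrite mulr0 addr0.
Qed.

Fact zero_ideal_prime : prime_idealr_closed zero_ideal.
Proof.
move=> u v; rewrite !unfold_in => /eqP uv0; case: eqVneq => //= /eqP u0.
by apply/eqP; exact: cusp_mulf uv0 u0.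
Qed.

Fact max_ideal_closed : idealr_closed max_ideal.
Proof.
split; rewrite /max_ideal ?unfold_in ?rmorph0 ?rmorph1 //; first exact: oner_neq0.
move=> a u v; rewrite !unfold_in => /eqP u0 /eqP v0.
by rewrite rmorphD rmorphM fcoefD fcoefM0 u0 v0 mulr0 addr0.
Qed.

Fact max_ideal_prime : prime_idealr_closed max_ideal.
Proof.
by move=> u v; rewrite /max_ideal !unfold_in rmorphM fcoefM0 mulf_eq0.
Qed.

HB.instance Definition _ := isIdealr.Build R zero_ideal zero_ideal_closed.
HB.instance Definition _ := isPrimeIdealrClosed.Build R zero_ideal zero_ideal_prime.
HB.instance Definition _ := isIdealr.Build R max_ideal max_ideal_closed.
HB.instance Definition _ := isPrimeIdealrClosed.Build R max_ideal max_ideal_prime.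

Lemma prime_sub_max (p : prime_idealr R) : {subset p <= max_ideal}.
Proof.
move=> r pr; rewrite unfold_in; apply/negPn/negP => /cusp_unit[r' e].
by have := idealMr r' pr; rewrite e idealr1.
Qed.

Lemma max_sub_prime (p : prime_idealr R) a : a \in p -> a <> 0 ->
  {subset max_ideal <= p}.
Proof.
move=> pa a0 r /eqP/rho_surj[s ->]; have [n [c e]] := nonunit_pow_dvd s a0.
have : rho s ^+ n \in p by rewrite e idealMr.
elim: n {e} => [|n IHn]; first by rewrite expr0 idealr1.
by rewrite exprS prime_idealrM => /orP[].
Qed.

Lemma krull_dim_cusp : is_krull_dim R 1.
Proof.
split.
  exists (fun i => if i is 0%N then zero_ideal : prime_idealr R else max_ideal).
  case=> // _; split; first exact: prime_sub_max.
  move=> /(_ X); rewrite !unfold_in phi_X coef_tX eqxx => /(_ isT) /eqP.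
  exact: X_neq0.
move=> m [p pP]; rewrite leqNgt; apply/negP => lt1m.
have [[_ np10] [_ np21]] := (pP 0%N (ltnW lt1m), pP 1%N lt1m).
have [a pa a0] : exists2 a, a \in p 1%N & a <> 0.
  apply: contrapT => na; apply: np10 => a pa; have [->|a0] := pselect (a = 0).
    exact: idealr0.
  by case: na; exists a.
by apply: np21 => b /prime_sub_max; exact: max_sub_prime pa a0 b.
Qed.

Lemma krull_dim_cusp_uniq n : is_krull_dim R n -> n = 1%N.
Proof.
move=> [chain nmax]; have [chain1 max1] := krull_dim_cusp.
by apply/eqP; rewrite eqn_leq max1 // nmax.
Qed.

Section CohenMacaulay.
Variable M : lmodType R.

Lemma seq_smul_nil (v : M) : seq_smul M [::] v <-> v = 0.
Proof.
split=> [[w ->]|->]; first by rewrite big_ord0.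
by exists (fun _ => 0); rewrite big_ord0.
Qed.

Lemma seq_smul1 (a : R) (v : M) : seq_smul M [:: a] v <-> exists w, v = a *: w.
Proof.
split=> [[w ->]|[w ->]]; first by exists (w 0%N); rewrite big_ord1.
by exists (fun _ => w); rewrite big_ord1.
Qed.

Lemma MCM_regular : is_MCM M ->
  exists a : R, [/\ forall v : M, X *: v = 0 -> v = 0, forall v : M, a *: v = 0 -> v = 0
                & exists v : M, forall w, v <> a *: w].
Proof.
move=> [_ _ [n [[s [snu [sreg [v vs]]] sn] _] /krull_dim_cusp_uniq en]].
move: sn snu sreg vs; rewrite en; case: s => [|a [|? ?]] // _ snu sreg vs.
have areg (u : M) : a *: u = 0 -> u = 0.
  have := sreg 0%N isT u; rewrite /= => reg0 au; apply/seq_smul_nil/reg0.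
  by rewrite au; apply/seq_smul_nil.
exists a; split=> // [u Xu|].
  have [s es] : exists s, a = rho s by apply/nonunitP/snu; rewrite mem_head.
  (* The square of [a] is a multiple of X, so it kills u, and [a] is cancelled twice. *)
  apply: (areg); apply: (areg); rewrite {1}es scalerA es.
  by rewrite rhoM mulrC -scalerA Xu scaler0.
by exists v => w e; apply: vs; apply/seq_smul1; exists w.
Qed.

Lemma MCM_intro (v0 : M) : fin_gen M -> (forall v : M, X *: v = 0 -> v = 0) ->
  (forall w, v0 <> X *: w) -> is_MCM M.
Proof.
move=> Mfg Xinj v0X; split=> //.
  exists v0; apply/eqP => v00; apply: (v0X 0); by rewrite scaler0.
exists 1%N; last exact: krull_dim_cusp.
split.
  exists [:: X] => //; split=> [a|].
    by rewrite inE => /eqP->; apply/nonunitP; exists 1.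
  split=> [[|i] //= _ v /seq_smul_nil/Xinj ->|]; first exact/seq_smul_nil.
  by exists v0 => /seq_smul1[w]; exact: v0X.
move=> [|a [|b s]] // [nu [reg [v nv]]].
have nva : ~ seq_smul M [:: a] v.
  move=> /seq_smul1[w e]; apply: nv; exists (fun i => if i is 0%N then w else 0).
  by rewrite /= big_ord_recl /= big1 ?addr0 // => i _; rewrite scaler0.
have a0 : a <> 0.
  move=> a0; apply: nva; apply/seq_smul1; exists 0; rewrite scaler0.
  have := reg 0%N isT v; rewrite /= a0 scale0r => reg0.
  by apply/seq_smul_nil/reg0/seq_smul_nil.
have [s' es] : exists s', b = rho s'.
  by apply/nonunitP/nu; rewrite !inE eqxx orbT.
(* A power of b is a multiple of a, so it sends v into a M; regularity of b modulo a M then removes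
   the factors b one by one and puts v itself into a M. *)
have [n [c e]] := nonunit_pow_dvd s' a0; rewrite -es in e.
have : seq_smul M [:: a] (b ^+ n *: v).
  by apply/seq_smul1; exists (c *: v); rewrite e mulrC scalerA.
elim: n {e} => [|n IHn]; first by rewrite scale1r => /nva.
rewrite exprS -scalerA => sn; apply: IHn.
exact: (reg 1%N).
Qed.

End CohenMacaulay.
End KrullDimension.

Section Spectrum.
Variable k : fieldType.
Notation R := (cusp_ring k).
Notation S := (normalization k).
Notation phi := (@phi k).
Notation t := (@fps_t k).

Lemma MCM_gldim_gt0 (M : lmodType R) : is_MCM M -> ~ gldim_le (End_ring M) 0.
Proof.
move=> /MCM_regular[a [_ ainj [v0 v0a]]] /(gldim_le0_split (scaling M a)).
move=> [e [f [ae0 e1]]].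
have e0 : e = 0.
  apply: End_ringP => v; apply: ainj.
  exact: (congr1 (fun f => End_fun f v) ae0).
apply: (v0a (End_fun f v0)); rewrite -linearZ.
rewrite e0 add0r in e1.
exact: (congr1 (fun f => End_fun f v0) e1).
Qed.

Lemma MCM_gldim (M : lmodType R) n : is_MCM M -> is_gldim (End_ring M) n ->
  n = 1%N \/ n = 2%N.
Proof.
move=> MCM [gln nmin]; have Mfg : fin_gen M by case: MCM.
have [a [Xinj ainj [v0 v0a]]] := MCM_regular MCM.
have [I [p [g [v1 [u2 [v2 Mdec]]]]]] := classification Xinj Mfg.
have n0 : n <> 0%N.
  by move=> n0; rewrite n0 in gln; exact: MCM_gldim_gt0 gln.
suff : (n <= 2)%N by case: n n0 {gln nmin} => [|[|[|n]]] //; [left|right].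
have [[i pi]|npI] := pselect (exists i, p i).
  have [[j npj]|pI] := pselect (exists j, ~~ p j).
    exact: nmin (gldim_le2 Mdec Xinj Mfg pi npj).
  apply: leq_trans (nmin 1%N _) _ => //; apply: (gldim_le1 Mdec) => // j.
  by apply/negPn/negP => npj; apply: pI; exists j.
have pI i : ~~ p i by apply/negP => pi; apply: npI; exists i.
have Mfree m : m = \sum_i (v1 i m : R) *: g i.
  case: Mdec => /(_ m) {1}-> _ _; rewrite [X in _ + X]big1 ?addr0 => [|i].
    by apply: eq_bigl => i; rewrite pI.
  by rewrite (negPf (pI i)).
have [[i _]|nI] := pselect (exists i : I, True).
  case: (@gldim_infinite _ _ Xinj I g v1 i n) => //.
  by case: Mdec => _ e _; exact: e.
(* Without summands M is zero, whereas [v0] lies outside a M. *)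
case: (v0a 0); rewrite scaler0 (Mfree v0) big1 // => i _.
by case: nI; exists i.
Qed.

Let S_span (s : S) : exists a b : R, s = a *: ((1 : fps k) : S) + b *: ((t : fps k) : S).
Proof.
exists (sect (s - cst (coef s 1) * t)), (kap (coef s 1)).
rewrite !normalization_scaleE phi_kap sectK ?mulr1 ?subrK //.
by rewrite fcoefB coef_cstM mulr1 subrr.
Qed.

Let S_not_divisible w : (1 : fps k) <> X *: (w : S) :> fps k.
Proof.
rewrite normalization_scaleE phi_X => /(congr1 (fun s => coef s 0)).
by rewrite coef_tXM => /eqP; rewrite oner_eq0.
Qed.

Lemma MCM_normalization : is_MCM S.
Proof.
apply: (MCM_intro _ (@normalization_torsion_free k) S_not_divisible).
exists 2%N, (fun i : 'I_2 => if i == ord0 then (1 : fps k) else t) => s.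
have [a [b e]] := S_span s; exists (fun i => if i == ord0 then a else b).
by rewrite !big_ord_recl big_ord0 addr0.
Qed.

Lemma gldim_normalization : is_gldim (End_ring S) 1.
Proof.
have gfg : fin_gen S by case: MCM_normalization.
have zlin : linear (fun _ : S => 0 : R^o) by move=> a x y; rewrite scaler0 addr0.
have dec : decomposition (I := unit) xpredT (fun _ => 0 : S) (fun _ => mklin zlin)
    (fun _ => [the {linear S -> S} of idfun]) (fun _ => [the {linear S -> S} of idfun]).
  by split=> // s; rewrite big_pred0 // add0r (big_pred1 tt).
have gl1 := gldim_le1 dec (@normalization_torsion_free k) gfg tt (fun _ => isT).
split=> // -[|m] // gl0; case: (MCM_gldim_gt0 MCM_normalization gl0).
Qed.

Local Notation RS := (R^o * S)%type.

Let Xinj_RS (v : RS) : X *: v = 0 -> v = 0.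
Proof.
case: v => r s e; congr pair; last exact: (@normalization_torsion_free k) (congr1 snd e).
by apply: (@cusp_mulf k X r); [exact: (congr1 fst e) | exact: X_neq0].
Qed.

Lemma MCM_sum : is_MCM (RS : lmodType R).
Proof.
apply: (@MCM_intro k RS (0, (1 : fps k) : S)) => // [|[r s] /(congr1 snd)]; last first.
  exact: S_not_divisible.
exists 3%N, (fun i : 'I_3 => if i == 0%N :> nat then (1 : R^o, 0 : S)
  else if i == 1%N :> nat then (0 : R^o, (1 : fps k) : S) else (0 : R^o, (t : fps k) : S)).
move=> [r s]; have [a [b e]] := S_span s.
exists (fun i => if i == 0%N :> nat then r else if i == 1%N :> nat then a else b).
rewrite !big_ord_recl big_ord0 addr0 /=; congr pair.
  by rewrite /= !scaler0 !addr0 [RHS]mulr1.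
by rewrite /= scaler0 add0r.
Qed.

Lemma gldim_sum : is_gldim (End_ring (RS : lmodType R)) 2.
Proof.
have gfg : fin_gen (RS : lmodType R) by case: MCM_sum.
have ilin : linear (fun s : S => (0, s) : RS).
  by move=> a x y; congr pair; rewrite /= scaler0 addr0.
(* The index type is bool: [true] stands for the summand S and [false] for the summand R. *)
have dec : decomposition id (fun _ => (1, 0) : RS)
    (fun _ => [the {linear RS -> R^o} of fst]) (fun _ => mklin ilin)
    (fun _ => [the {linear RS -> S} of snd]).
  split=> // -[r s].
  rewrite (big_pred1 false) => [|[]] //; rewrite (big_pred1 true) => [|[]] //.
  by congr pair; rewrite /= ?scaler0 ?addr0 ?add0r // [RHS]mulr1.
split; first exact: (@gldim_le2 _ _ _ _ _ _ _ _ dec Xinj_RS gfg true false).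
move=> [|[|m]] // gl.
  by case: (MCM_gldim_gt0 MCM_sum gl).
by case: (@gldim_gt1 k RS (1, 0) [the {linear RS -> R^o} of fst] erefl gl).
Qed.

End Spectrum.

Local Open Scope classical_set_scope.

Theorem proposition4p11 (k : fieldType) :
  global_spectrum (cusp_ring k) = [set 1%N; 2%N].
Proof.
apply/seteqP; split=> n /=.
  by move=> [M MCM gl]; exact: MCM_gldim MCM gl.
case=> ->.
  exists (normalization k); [exact: MCM_normalization | exact: gldim_normalization].
exists ((cusp_ring k)^o * normalization k)%type; [exact: MCM_sum | exact: gldim_sum].
Qed.
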